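(* Let $m\ge 1$. For all $d\geq 0$, the motive of $Z^{(m)}(\mathbb{C}^d)$, considered in the localized Grothendieck ring of complex varieties $R=K_0({\rm Var}_\mathbb{C})[\mathbb{L}^{-1},(1-\mathbb{L}^i)^{-1} : i\geq 1]$, is given by $$[Z^{(m)}(\mathbb{C}^d)]=\frac{(\mathbb{L};\mathbb{L}^{m-1})_d}{(1-\mathbb{L})^d}=\prod_{i=0}^{d-1}\frac{\mathbb{L}^{(m-1)i+1}-1}{\mathbb{L}-1}.$$
   Context: $K_0({\rm Var}_\mathbb{C})$ is the Grothendieck ring of complex varieties, $[X]$ is the class (''motive'') of $X$, and $\mathbb{L}=[\mathbb{A}^1]$ is the Lefschetz motive. The $q$-Pochhammer symbol is $(a;q)_n=\prod_{k=0}^{n-1}(1-aq^k)$. Definition of $Z^{(m)}(V)$ for a complex vector space $V$ of dimension $d$: write $\varphi_*=(\varphi_1,\ldots,\varphi_m)\in{\rm End}(V)^m$. The group ${\rm GL}(V)$ acts on ${\rm End}(V)^m\times V$ by $g\cdot(\varphi_*,v)=(g\varphi_1g^{-1},\ldots,g\varphi_mg^{-1},gv)$. A point $(\varphi_*,v)$ is stable if $\mathbb{C}\langle\varphi_1,\ldots,\varphi_m\rangle\cdot v=V$. Fix a complete flag $0=F^0_0\subset F^0_1\subset\ldots\subset F^0_d=V$ with stabilizer the Borel subgroup $B(V)\subset{\rm GL}(V)$, let $\mathfrak{n}(V)$ be the space of operators $\varphi\in{\rm End}(V)$ with $\varphi(F^0_i)\subset F^0_{i-1}$ for all $i=1,\ldots,d$,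 and let $(\mathfrak{n}(V)^m\times V)_{\rm st}$ be the open subset of stable points in $\mathfrak{n}(V)^m\times V$. It admits a geometric quotient by $B(V)$, and $Z^{(m)}(V)=(\mathfrak{n}(V)^m\times V)_{\rm st}/B(V)$. Equivalently, $Z^{(m)}(V)=Y^{(m)}(V)/{\rm GL}(V)$, where $Y^{(m)}(V)$ is the variety of tuples $((\varphi_*,v),F_* )$ consisting of a stable point $(\varphi_*,v)\in{\rm End}(V)^m\times V$ and a complete flag $F_*$ of $V$ with $\varphi_k(F_i)\subset F_{i-1}$ for all $k,i$. *)

(* Defs.v *)
From HB Require Import structures.
From mathcomp Require Import all_boot all_order all_algebra.
From mathcomp Require Import boolp classical_sets.
From mathcomp Require Import mpoly.

Set Implicit Arguments.
Unset Strict Implicit.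
Unset Printing Implicit Defensive.

Import GRing.Theory.
Local Open Scope classical_set_scope.
Local Open Scope ring_scope.

(** * Commutative rings given by generators and relations *)

Inductive rterm (G : Type) : Type :=
| TGen of G
| TZero
| TOne
| TOpp of rterm G
| TAdd of rterm G & rterm G
| TMul of rterm G & rterm G.

Arguments TZero {G}.
Arguments TOne {G}.

Section PresentedRing.
Variables (G : Type) (rel : rterm G -> rterm G -> Prop).

(* The least congruence containing [rel] and the commutative ring axioms. *)
Inductive rcong : rterm G -> rterm G -> Prop :=
| rcong_rel x y : rel x y -> rcong x y
| rcong_refl x : rcong x x
| rcong_sym x y : rcong x y -> rcong y x
| rcong_trans x y z : rcong x y -> rcong y z -> rcong x z
| rcong_opp x x' : rcong x x' -> rcong (TOpp x) (TOpp x')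
| rcong_add x x' y y' :
    rcong x x' -> rcong y y' -> rcong (TAdd x y) (TAdd x' y')
| rcong_mul x x' y y' :
    rcong x x' -> rcong y y' -> rcong (TMul x y) (TMul x' y')
| rcong_addA x y z : rcong (TAdd x (TAdd y z)) (TAdd (TAdd x y) z)
| rcong_addC x y : rcong (TAdd x y) (TAdd y x)
| rcong_add0 x : rcong (TAdd TZero x) x
| rcong_addN x : rcong (TAdd (TOpp x) x) TZero
| rcong_mulA x y z : rcong (TMul x (TMul y z)) (TMul (TMul x y) z)
| rcong_mulC x y : rcong (TMul x y) (TMul y x)
| rcong_mul1 x : rcong (TMul TOne x) x
| rcong_mulDl x y z :
    rcong (TMul (TAdd x y) z) (TAdd (TMul x z) (TMul y z)).

Definition rcongb (x y : {classic rterm G}) : bool := `[< rcong x y >].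

Lemma rcongb_refl : reflexive rcongb.
Proof. by move=> x; apply/asboolP; exact: rcong_refl. Qed.

Lemma rcongb_sym : ssrbool.symmetric rcongb.
Proof.
by move=> x y; apply/idP/idP => /asboolP ?; apply/asboolP; exact: rcong_sym.
Qed.

Lemma rcongb_trans : transitive rcongb.
Proof.
move=> y x z /asboolP xy /asboolP yz; apply/asboolP.
exact: rcong_trans xy yz.
Qed.

Canonical rcong_equiv := EquivRel rcongb rcongb_refl rcongb_sym rcongb_trans.

Definition presented_ring : Type := {eq_quot rcongb}%qT.
HB.instance Definition _ := Choice.on presented_ring.

Definition rclass (x : rterm G) : presented_ring :=
  (\pi_({eq_quot rcongb}) (x : {classic rterm G}))%qT.

Definition rgen (g : G) : presented_ring := rclass (TGen g).

Definition rrepr (a : presented_ring) : rterm G :=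
  (repr (a : {eq_quot rcongb}))%qT.

Lemma rreprK a : rclass (rrepr a) = a.
Proof. exact: reprK. Qed.

Lemma rclass_eq x y : rclass x = rclass y <-> rcong x y.
Proof.
split=> [/eqmodP /asboolP //|xy].
by apply/eqmodP; apply/asboolP.
Qed.

Lemma rrepr_class x : rcong (rrepr (rclass x)) x.
Proof. by apply/rclass_eq; rewrite rreprK. Qed.

Definition pr_zero : presented_ring := rclass TZero.
Definition pr_one : presented_ring := rclass TOne.
Definition pr_opp (a : presented_ring) := rclass (TOpp (rrepr a)).
Definition pr_add (a b : presented_ring) := rclass (TAdd (rrepr a) (rrepr b)).
Definition pr_mul (a b : presented_ring) := rclass (TMul (rrepr a) (rrepr b)).

Lemma rclassN x : pr_opp (rclass x) = rclass (TOpp x).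
Proof. by apply/rclass_eq; apply: rcong_opp; exact: rrepr_class. Qed.

Lemma rclassD x y : pr_add (rclass x) (rclass y) = rclass (TAdd x y).
Proof. by apply/rclass_eq; apply: rcong_add; exact: rrepr_class. Qed.

Lemma rclassM x y : pr_mul (rclass x) (rclass y) = rclass (TMul x y).
Proof. by apply/rclass_eq; apply: rcong_mul; exact: rrepr_class. Qed.

Fact pr_addA : associative pr_add.
Proof.
move=> a b c; rewrite -[a]rreprK -[b]rreprK -[c]rreprK !rclassD.
by apply/rclass_eq; exact: rcong_addA.
Qed.

Fact pr_addC : commutative pr_add.
Proof.
by move=> a b; apply/rclass_eq; exact: rcong_addC.
Qed.

Fact pr_add0 : left_id pr_zero pr_add.
Proof.
move=> a; rewrite -[a]rreprK rclassD.
by apply/rclass_eq; exact: rcong_add0.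
Qed.

Fact pr_addN : left_inverse pr_zero pr_opp pr_add.
Proof.
move=> a; rewrite -[a]rreprK rclassN rclassD.
by apply/rclass_eq; exact: rcong_addN.
Qed.

HB.instance Definition _ :=
  GRing.isZmodule.Build presented_ring pr_addA pr_addC pr_add0 pr_addN.

Fact pr_mulA : associative pr_mul.
Proof.
move=> a b c; rewrite -[a]rreprK -[b]rreprK -[c]rreprK !rclassM.
by apply/rclass_eq; exact: rcong_mulA.
Qed.

Fact pr_mulC : commutative pr_mul.
Proof.
by move=> a b; apply/rclass_eq; exact: rcong_mulC.
Qed.

Fact pr_mul1 : left_id pr_one pr_mul.
Proof.
move=> a; rewrite -[a]rreprK rclassM.
by apply/rclass_eq; exact: rcong_mul1.
Qed.

Fact pr_mulDl : left_distributive pr_mul pr_add.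
Proof.
move=> a b c; rewrite -[a]rreprK -[b]rreprK -[c]rreprK.
rewrite (rclassD (rrepr a)) !rclassM rclassD.
by apply/rclass_eq; exact: rcong_mulDl.
Qed.

HB.instance Definition _ :=
  GRing.Zmodule_isComPzRing.Build presented_ring
    pr_mulA pr_mulC pr_mul1 pr_mulDl.

Lemma rclass_add x y : rclass (TAdd x y) = rclass x + rclass y.
Proof. by rewrite -rclassD. Qed.

Lemma rclass_mul x y : rclass (TMul x y) = rclass x * rclass y.
Proof. by rewrite -rclassM. Qed.

Lemma rclass_opp x : rclass (TOpp x) = - rclass x.
Proof. by rewrite -rclassN. Qed.

Lemma rclass0 : rclass TZero = 0. Proof. by []. Qed.

Lemma rclass1 : rclass TOne = 1. Proof. by []. Qed.

End PresentedRing.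

(** * Localization of a commutative ring

    [localization S] is A[x_s : s in S] / (s x_s - 1 : s in S), i.e. the ring
    obtained from A by adjoining an inverse of every element of S. *)

Section Localization.
Variables (A : comPzRingType) (S : set A).

Inductive loc_rel : rterm (A + {s : A | S s}) -> rterm (A + {s : A | S s})
    -> Prop :=
| loc_rel1 : loc_rel (TGen (inl 1)) TOne
| loc_relD a b :
    loc_rel (TGen (inl (a + b))) (TAdd (TGen (inl a)) (TGen (inl b)))
| loc_relM a b :
    loc_rel (TGen (inl (a * b))) (TMul (TGen (inl a)) (TGen (inl b)))
| loc_relV s : loc_rel (TMul (TGen (inl (sval s))) (TGen (inr s))) TOne.

Definition localization := presented_ring loc_rel.
HB.instance Definition _ := GRing.ComPzRing.on localization.

Definition to_loc (a : A) : localization := rgen loc_rel (inl a).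

Fact to_loc1 : to_loc 1 = 1.
Proof. by apply/rclass_eq; apply: rcong_rel; exact: loc_rel1. Qed.

Fact to_locD a b : to_loc (a + b) = to_loc a + to_loc b.
Proof.
rewrite -rclass_add; apply/rclass_eq; apply: rcong_rel; exact: loc_relD.
Qed.

Fact to_locM a b : to_loc (a * b) = to_loc a * to_loc b.
Proof.
rewrite -rclass_mul; apply/rclass_eq; apply: rcong_rel; exact: loc_relM.
Qed.

Fact to_loc0 : to_loc 0 = 0.
Proof. by apply: (addrI (to_loc 0)); rewrite -to_locD !addr0. Qed.

HB.instance Definition _ :=
  GRing.isNmodMorphism.Build A localization to_loc (conj to_loc0 to_locD).
HB.instance Definition _ :=
  GRing.isMonoidMorphism.Build A localization to_loc (conj to_loc1 to_locM).

Lemma to_loc_inv s : S s -> exists u, to_loc s * u = 1.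
Proof.
move=> Ss; exists (rgen loc_rel (inr (exist _ s Ss))).
rewrite -rclass_mul -rclass1; apply/rclass_eq; apply: rcong_rel.
exact: (loc_relV (exist _ s Ss)).
Qed.

End Localization.

(* The inverse of x if x is invertible, and 0 otherwise. MathComp's [x^-1]
   needs 1 != 0, which is not part of the definition of the rings above. *)
Definition uinv (A : comPzRingType) (x : A) : A := xget 0 [set y | x * y = 1].

Lemma uinvP (A : comPzRingType) (x y : A) : x * y = 1 -> x * uinv x = 1.
Proof. by move=> xy1; rewrite /uinv; case: xgetP => [z _ //|/(_ y)]. Qed.

(** * Spaces with functions and varieties over an algebraically closed field *)

(* A topology on T with a sheaf of k-valued functions, closed under the
   k-algebra operations and under inverting a function where it is nonzero.
   [reg_on U f] says that U is open and that the restriction of f to U is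
   regular; the values of f outside U are irrelevant. *)
Record space_on (k : closedFieldType) (T : Type) := SpaceOn {
  opn_on : set T -> Prop;
  reg_on : set T -> (T -> k) -> Prop;
  opn_onT : opn_on setT;
  opn_onI : forall U V, opn_on U -> opn_on V -> opn_on (U `&` V);
  opn_on_bigcup : forall F : set (set T),
    (forall U, F U -> opn_on U) -> opn_on (\bigcup_(U in F) U);
  reg_on_opn : forall U f, reg_on U f -> opn_on U;
  reg_on_sub : forall U V f,
    reg_on U f -> opn_on V -> V `<=` U -> reg_on V f;
  reg_on_eq : forall U f g,
    reg_on U f -> (forall x, U x -> f x = g x) -> reg_on U g;
  reg_on_glue : forall U f, opn_on U ->
    (forall x, U x -> exists V, [/\ V x, V `<=` U & reg_on V f]) -> reg_on U f;
  reg_on_cst : forall U c, opn_on U -> reg_on U (fun=> c);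
  reg_onD : forall U f g,
    reg_on U f -> reg_on U g -> reg_on U (fun x => f x + g x);
  reg_onM : forall U f g,
    reg_on U f -> reg_on U g -> reg_on U (fun x => f x * g x);
  reg_onV : forall U f, reg_on U f ->
    reg_on (U `&` [set x | f x != 0]) (fun x => (f x)^-1)
}.

Record space (k : closedFieldType) := Space {
  pt :> Type;
  pt_space : space_on k pt
}.

Section SpaceTheory.
Variables (k : closedFieldType) (X : space k).
Implicit Types (U V : set X) (f g : X -> k).

Definition opn U : Prop := opn_on (pt_space X) U.
Definition reg U f : Prop := reg_on (pt_space X) U f.

Lemma opnT : opn setT. Proof. exact: opn_onT. Qed.

Lemma opnI U V : opn U -> opn V -> opn (U `&` V).
Proof. exact: opn_onI. Qed.

Lemma opn_bigcup (F : set (set X)) :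
  (forall U, F U -> opn U) -> opn (\bigcup_(U in F) U).
Proof. exact: opn_on_bigcup. Qed.

Lemma reg_opn U f : reg U f -> opn U.
Proof. exact: reg_on_opn. Qed.

Lemma reg_sub U V f : reg U f -> opn V -> V `<=` U -> reg V f.
Proof. exact: reg_on_sub. Qed.

Lemma reg_eq U f g : reg U f -> (forall x, U x -> f x = g x) -> reg U g.
Proof. exact: reg_on_eq. Qed.

Lemma reg_glue U f : opn U ->
  (forall x, U x -> exists V, [/\ V x, V `<=` U & reg V f]) -> reg U f.
Proof. exact: reg_on_glue. Qed.

Lemma reg_cst U c : opn U -> reg U (fun=> c).
Proof. exact: reg_on_cst. Qed.

Lemma regD U f g : reg U f -> reg U g -> reg U (fun x => f x + g x).
Proof. exact: reg_onD. Qed.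

Lemma regM U f g : reg U f -> reg U g -> reg U (fun x => f x * g x).
Proof. exact: reg_onM. Qed.

Lemma regV U f : reg U f ->
  reg (U `&` [set x | f x != 0]) (fun x => (f x)^-1).
Proof. exact: reg_onV. Qed.

Lemma opn_local U :
  (forall x, U x -> exists V, [/\ opn V, V x & V `<=` U]) -> opn U.
Proof.
move=> UV; have -> : U = \bigcup_(V in [set V | opn V /\ V `<=` U]) V.
  apply/seteqP; split=> [x /UV [V [oV Vx VU]]|x [V [_ VU] /VU //]].
  by exists V.
by apply: opn_bigcup => V [].
Qed.

End SpaceTheory.

Definition clsd (k : closedFieldType) (X : space k) (S : set X) : Prop :=
  opn (~` S).

Definition morphism (k : closedFieldType) (X Y : space k) (f : X -> Y) : Prop :=
  (forall U : set Y, opn U -> opn (f @^-1` U)) /\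
  (forall (U : set Y) (g : Y -> k), reg U g -> reg (f @^-1` U) (g \o f)).

Definition isomorphic (k : closedFieldType) (X Y : space k) : Prop :=
  exists (f : X -> Y) (g : Y -> X),
    [/\ morphism f, morphism g, cancel f g & cancel g f].

Lemma morphism_comp (k : closedFieldType) (X Y Z : space k) (f : X -> Y)
    (g : Y -> Z) : morphism f -> morphism g -> morphism (g \o f).
Proof.
move=> [of_ rf] [og rg]; split=> [U oU|U h rh]; first exact: of_ (og _ oU).
exact: rf (rg _ _ rh).
Qed.

(** ** A vector space as an affine space *)

Section Affine.
Variables (k : closedFieldType) (W : vectType k).

(* Evaluation of a polynomial in the coordinates of W; a linear change of
   coordinates does not affect the notions defined from it. *)
Definition peval (P : {mpoly k[\dim {:W}]}) (w : W) : k :=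
  P.@[fun i => coord (vbasis {:W}) i w].

Definition zeros (I : set {mpoly k[\dim {:W}]}) : set W :=
  [set w | forall P, I P -> peval P w = 0].

Definition aff_opn (U : set W) : Prop := exists I, ~` U = zeros I.

Definition aff_reg (U : set W) (f : W -> k) : Prop :=
  aff_opn U /\
  forall x, U x -> exists P Q : {mpoly k[\dim {:W}]},
    peval Q x != 0 /\
    forall y, U y -> peval Q y != 0 -> f y = peval P y / peval Q y.

Lemma pevalM P Q w : peval (P * Q) w = peval P w * peval Q w.
Proof. exact: mevalM. Qed.

Lemma pevalD P Q w : peval (P + Q) w = peval P w + peval Q w.
Proof. exact: mevalD. Qed.

Lemma pevalC c w : peval c%:MP w = c.
Proof. exact: mevalC. Qed.

Lemma aff_opnP U : aff_opn U <->
  forall x, U x -> exists P, peval P x != 0 /\ forall y, peval P y != 0 -> U y.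
Proof.
split=> [[I UI] x Ux|UP].
  apply: contrapT => /forallNP nP.
  suff : (~` U) x by [].
  rewrite UI => P IP; apply: contrapT => /eqP Px; apply: (nP P); split=> // y.
  move=> /eqP Py; apply: contrapT => nUy.
  by have : (~` U) y by []; rewrite UI => /(_ P IP).
exists [set P | forall y, peval P y != 0 -> U y].
apply/seteqP; split=> [x nUx P /= PU|x xI Ux].
  by apply: contrapT => /eqP /PU.
by have [P [Px PU]] := UP x Ux; move: Px; rewrite (xI P PU) eqxx.
Qed.

Fact aff_opnT : aff_opn setT.
Proof.
apply/aff_opnP => x _; exists (1%:MP); split=> //.
by rewrite pevalC oner_neq0.
Qed.

Fact aff_opnI U V : aff_opn U -> aff_opn V -> aff_opn (U `&` V).
Proof.
move=> /aff_opnP oU /aff_opnP oV; apply/aff_opnP => x [Ux Vx].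
have [P [Px PU]] := oU x Ux; have [Q [Qx QV]] := oV x Vx.
exists (P * Q); split=> [|y]; first by rewrite pevalM mulf_neq0.
by rewrite pevalM mulf_eq0 negb_or => /andP[/PU ? /QV ?].
Qed.

Fact aff_opn_bigcup (F : set (set W)) :
  (forall U, F U -> aff_opn U) -> aff_opn (\bigcup_(U in F) U).
Proof.
move=> oF; apply/aff_opnP => x [U FU Ux].
have /aff_opnP/(_ x Ux) [P [Px PU]] := oF U FU.
by exists P; split=> // y /PU Uy; exists U.
Qed.

Fact aff_reg_opn U f : aff_reg U f -> aff_opn U.
Proof. by case. Qed.

Fact aff_reg_sub U V f : aff_reg U f -> aff_opn V -> V `<=` U -> aff_reg V f.
Proof.
move=> [_ rf] oV VU; split=> // x /VU Ux.
have [P [Q [Qx fPQ]]] := rf x Ux; exists P, Q; split=> // y /VU; exact: fPQ.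
Qed.

Fact aff_reg_eq U f g :
  aff_reg U f -> (forall x, U x -> f x = g x) -> aff_reg U g.
Proof.
move=> [oU rf] fg; split=> // x Ux.
have [P [Q [Qx fPQ]]] := rf x Ux; exists P, Q; split=> // y Uy Qy.
by rewrite -fg // fPQ.
Qed.

Fact aff_reg_glue U f : aff_opn U ->
  (forall x, U x -> exists V, [/\ V x, V `<=` U & aff_reg V f]) -> aff_reg U f.
Proof.
move=> oU rf; split=> // x Ux; have [V [Vx VU [/aff_opnP oV rV]]] := rf x Ux.
have [P [Q [Qx fPQ]]] := rV x Vx; have [S [Sx SV]] := oV x Vx.
exists (P * S), (Q * S); split=> [|y Uy]; first by rewrite pevalM mulf_neq0.
rewrite !pevalM mulf_eq0 negb_or => /andP[Qy Sy].
by have Vy := SV y Sy; rewrite fPQ // invfM mulrACA divff // mulr1.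
Qed.

Fact aff_reg_cst U c : aff_opn U -> aff_reg U (fun=> c).
Proof.
move=> oU; split=> // x Ux; exists c%:MP, 1%:MP.
by split=> [|y _ _]; rewrite ?pevalC ?oner_neq0 // divr1.
Qed.

Fact aff_regD U f g :
  aff_reg U f -> aff_reg U g -> aff_reg U (fun x => f x + g x).
Proof.
move=> [oU rf] [_ rg]; split=> // x Ux.
have [P [Q [Qx fPQ]]] := rf x Ux; have [P' [Q' [Qx' gPQ]]] := rg x Ux.
exists (P * Q' + P' * Q), (Q * Q').
split=> [|y Uy]; first by rewrite pevalM mulf_neq0.
rewrite pevalD !pevalM mulf_eq0 negb_or => /andP[Qy Qy'].
by rewrite fPQ // gPQ // addf_div.
Qed.

Fact aff_regM U f g :
  aff_reg U f -> aff_reg U g -> aff_reg U (fun x => f x * g x).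
Proof.
move=> [oU rf] [_ rg]; split=> // x Ux.
have [P [Q [Qx fPQ]]] := rf x Ux; have [P' [Q' [Qx' gPQ]]] := rg x Ux.
exists (P * P'), (Q * Q'); split=> [|y Uy]; first by rewrite pevalM mulf_neq0.
rewrite !pevalM mulf_eq0 negb_or => /andP[Qy Qy'].
by rewrite fPQ // gPQ // mulf_div.
Qed.

Fact aff_regV U f : aff_reg U f ->
  aff_reg (U `&` [set x | f x != 0]) (fun x => (f x)^-1).
Proof.
move=> [/aff_opnP oU rf]; split.
  apply/aff_opnP => x [Ux fx]; have [S [Sx SU]] := oU x Ux.
  have [P [Q [Qx fPQ]]] := rf x Ux; exists (S * (P * Q)).
  have Px : peval P x != 0.
    by apply: contraNneq fx; rewrite fPQ // => ->; rewrite mul0r.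
  split=> [|y]; first by rewrite !pevalM !mulf_neq0.
  rewrite !pevalM !mulf_eq0 !negb_or => /and3P[/SU Uy Py Qy].
  by split=> //=; rewrite fPQ // mulf_neq0 // invr_eq0.
move=> x [Ux /= fx]; have [P [Q [Qx fPQ]]] := rf x Ux.
have Px : peval P x != 0.
  by apply: contraNneq fx; rewrite fPQ // => ->; rewrite mul0r.
exists (Q * Q), (P * Q); split=> [|y [Uy _]]; first by rewrite pevalM mulf_neq0.
rewrite !pevalM mulf_eq0 negb_or => /andP[Py Qy].
by rewrite fPQ // invf_div invfM mulrACA divff // mulr1 mulrC.
Qed.

Definition affine : space k :=
  Space (SpaceOn aff_opnT aff_opnI aff_opn_bigcup aff_reg_opn aff_reg_sub
    aff_reg_eq aff_reg_glue aff_reg_cst aff_regD aff_regM aff_regV).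

Lemma reg_coord i : @reg _ affine setT (fun w : W => coord (vbasis {:W}) i w).
Proof.
split=> [|x _]; first exact: aff_opnT.
exists 'X_i, 1%:MP; split=> [|y _ _]; rewrite pevalC ?oner_neq0 //.
by rewrite divr1 /peval mevalXU.
Qed.

End Affine.

(** ** The structure induced by a map, and in particular on a subset *)

Section Induced.
Variables (k : closedFieldType) (X : space k) (T : Type) (i : T -> X).

Definition ind_opn (U : set T) : Prop :=
  exists2 V : set X, opn V & U = i @^-1` V.

Definition ind_reg (U : set T) (f : T -> k) : Prop :=
  ind_opn U /\
  forall x, U x -> exists (V : set X) (g : X -> k),
    [/\ reg V g, V (i x) &
        forall y, U y -> V (i y) -> f y = g (i y)].

Fact ind_opnT : ind_opn setT.
Proof. by exists setT => //; exact: opnT. Qed.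

Fact ind_opnI U V : ind_opn U -> ind_opn V -> ind_opn (U `&` V).
Proof.
by move=> [U' oU ->] [V' oV ->]; exists (U' `&` V') => //; exact: opnI.
Qed.

Fact ind_opn_bigcup (F : set (set T)) :
  (forall U, F U -> ind_opn U) -> ind_opn (\bigcup_(U in F) U).
Proof.
move=> oF.
exists (\bigcup_(V in [set V | opn V /\ F (i @^-1` V)]) V).
  by apply: opn_bigcup => V [].
apply/seteqP; split=> [x [U FU Ux]|x [V [_ FV] Vx]]; last first.
  by exists (i @^-1` V).
have [V oV UV] := oF U FU; exists V; last by move: Ux; rewrite UV.
by split=> //; rewrite -UV.
Qed.

Fact ind_reg_opn U f : ind_reg U f -> ind_opn U.
Proof. by case. Qed.

Fact ind_reg_sub U V f : ind_reg U f -> ind_opn V -> V `<=` U -> ind_reg V f.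
Proof.
move=> [_ rf] oV VU; split=> // x /VU Ux.
by have [O [g [rg Ox fg]]] := rf x Ux; exists O, g; split=> // y /VU; exact: fg.
Qed.

Fact ind_reg_eq U f g :
  ind_reg U f -> (forall x, U x -> f x = g x) -> ind_reg U g.
Proof.
move=> [oU rf] fg; split=> // x Ux; have [O [h [rh Ox fh]]] := rf x Ux.
by exists O, h; split=> // y Uy Oy; rewrite -fg // fh.
Qed.

Fact ind_reg_glue U f : ind_opn U ->
  (forall x, U x -> exists V, [/\ V x, V `<=` U & ind_reg V f]) -> ind_reg U f.
Proof.
move=> oU rf; split=> // x Ux; have [V [Vx VU [[V' oV' eV] rV]]] := rf x Ux.
have [O [g [rg Ox fg]]] := rV x Vx; exists (V' `&` O), g; split.
- apply: (reg_sub rg); last by move=> ? [].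
  by apply: opnI => //; exact: reg_opn rg.
- by split=> //; move: Vx; rewrite eV.
- by move=> y Uy [Vy Oy]; apply: fg => //; rewrite eV.
Qed.

Fact ind_reg_cst U c : ind_opn U -> ind_reg U (fun=> c).
Proof.
move=> oU; split=> // x _; exists setT, (fun=> c); split=> //.
by apply: reg_cst; exact: opnT.
Qed.

Fact ind_regD U f g :
  ind_reg U f -> ind_reg U g -> ind_reg U (fun x => f x + g x).
Proof.
move=> [oU rf] [_ rg]; split=> // x Ux.
have [V [a [ra Vx fa]]] := rf x Ux; have [O [b [rb Ox gb]]] := rg x Ux.
have oVO : opn (V `&` O) by apply: opnI; [exact: reg_opn ra|exact: reg_opn rb].
exists (V `&` O), (fun x => a x + b x); split=> //.
  by apply: regD; [apply: (reg_sub ra)|apply: (reg_sub rb)] => // ? [].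
by move=> y Uy [Vy Oy]; rewrite fa // gb.
Qed.

Fact ind_regM U f g :
  ind_reg U f -> ind_reg U g -> ind_reg U (fun x => f x * g x).
Proof.
move=> [oU rf] [_ rg]; split=> // x Ux.
have [V [a [ra Vx fa]]] := rf x Ux; have [O [b [rb Ox gb]]] := rg x Ux.
have oVO : opn (V `&` O) by apply: opnI; [exact: reg_opn ra|exact: reg_opn rb].
exists (V `&` O), (fun x => a x * b x); split=> //.
  by apply: regM; [apply: (reg_sub ra)|apply: (reg_sub rb)] => // ? [].
by move=> y Uy [Vy Oy]; rewrite fa // gb.
Qed.

Lemma ind_opn_local U :
  (forall x, U x -> exists V : set X,
    [/\ opn V, V (i x) & forall y : T, V (i y) -> U y]) -> ind_opn U.
Proof.
move=> UV.
exists (\bigcup_(V in [set V | opn V /\ forall y : T, V (i y) -> U y]) V).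
  by apply: opn_bigcup => V [].
apply/seteqP; split=> [x /UV [V [oV Vx VU]]|x [V [_ VU] Vx]]; last exact: VU.
by exists V.
Qed.

Fact ind_regV U f : ind_reg U f ->
  ind_reg (U `&` [set x | f x != 0]) (fun x => (f x)^-1).
Proof.
move=> [[U' oU' eU] rf]; split.
  apply: ind_opn_local => x [Ux /= fx].
  have [V [g [rg Vx fg]]] := rf x Ux; have /reg_opn oD := regV rg.
  exists (U' `&` (V `&` [set x | g x != 0])); split; first exact: opnI.
    by split; [move: Ux; rewrite eU|split=> //=; rewrite -fg].
  move=> y [Uy [Vy gy]]; have Uy' : U y by rewrite eU.
  by split=> //=; rewrite fg.
move=> x [Ux /= fx]; have [V [g [rg Vx fg]]] := rf x Ux.
exists (V `&` [set x | g x != 0]), (fun x => (g x)^-1); split.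
- exact: regV.
- by split=> //=; rewrite -fg.
- by move=> y [Uy _] [Vy _]; rewrite fg.
Qed.

Definition induced_on : space_on k T :=
  SpaceOn ind_opnT ind_opnI ind_opn_bigcup ind_reg_opn ind_reg_sub ind_reg_eq
    ind_reg_glue ind_reg_cst ind_regD ind_regM ind_regV.

Definition induced : space k := Space induced_on.

Lemma induced_morphism : morphism (i : induced -> X).
Proof.
split=> [U oU|U f rf]; first by exists U.
split=> [|x Ux]; first by exists U => //; exact: reg_opn rf.
by exists U, f.
Qed.

Lemma morphism_induced (Y : space k) (g : Y -> induced) :
  morphism (i \o g : Y -> X) -> morphism g.
Proof.
move=> [oig rig].
have og (U : set induced) : opn U -> opn (g @^-1` U).
  by move=> [V oV ->]; exact: (oig V).
split=> // U f rf; have oU := og _ (reg_opn rf); apply: reg_glue => // y Uy.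
have [V [a [ra Vy fa]]] := rf.2 _ Uy; have rga := rig _ _ ra.
exists (g @^-1` U `&` (i \o g) @^-1` V); split; [by []|by move=> ? []|].
apply: (@reg_eq _ _ _ (a \o (i \o g))) => [|z [Uz Vz]]; last by rewrite /= fa.
by apply: (reg_sub rga); [exact: opnI oU (reg_opn rga)|move=> ? []].
Qed.

End Induced.

Definition subspace (k : closedFieldType) (X : space k) (S : set X) : space k :=
  induced (sval : {x : X | S x} -> X).

(** ** Varieties *)

Section Varieties.
Variable k : closedFieldType.

Definition is_affine (X : space k) : Prop :=
  exists (W : vectType k) (S : set (affine W)),
    clsd S /\ isomorphic X (subspace S).

Definition is_prevariety (X : space k) : Prop :=
  exists (n : nat) (U : 'I_n -> set X),
    (forall i, opn (U i) /\ is_affine (subspace (U i))) /\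
    (forall x, exists i, U i x).

(* The diagonal of X x X is closed; the coincidence sets of pairs of morphisms
   are the pullbacks of the diagonal. *)
Definition separated (X : space k) : Prop :=
  forall (T : space k) (f g : T -> X), morphism f -> morphism g ->
    clsd [set t | f t = g t].

(* Varieties need not be irreducible or nonempty. Only the size of the
   underlying set is restricted: as k is infinite, every separated prevariety,
   being covered by finitely many closed subsets of some k^n, is isomorphic to
   one whose points are taken from [seq k]. So that the varieties form a type
   in the universe of k, they are given by their structure on such a set. *)
Record variety := Variety {
  var_pts : set (seq k);
  var_on : space_on k {s : seq k | var_pts s};
  var_prevariety : is_prevariety (Space var_on);
  var_separated : separated (Space var_on)
}.

Definition var_space (X : variety) : space k := Space (var_on X).
Coercion var_space : variety >-> space.

Definition is_product (X Y P : variety) (p : P -> X) (q : P -> Y) : Prop :=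
  [/\ morphism p, morphism q &
      forall (T : variety) (f : T -> X) (g : T -> Y),
        morphism f -> morphism g ->
        exists! h : T -> P, [/\ morphism h, p \o h = f & q \o h = g]].

Lemma affine_separated (W : vectType k) : separated (affine W).
Proof.
move=> T f g [_ mf] [_ mg]; apply: opn_local => t /eqP fgt.
have [i /eqP fgi] : exists i,
    coord (vbasis {:W}) i (f t : W) <> coord (vbasis {:W}) i (g t : W).
  apply: contrapT => /forallNP fg; move/eqP: fgt; apply.
  rewrite [LHS](coord_vbasis (memvf (f t : W))).
  rewrite [RHS](coord_vbasis (memvf (g t : W))).
  by apply: eq_bigr => i _; congr (_ *: _); apply: contrapT; exact: fg.
have rf := mf _ _ (reg_coord i); have rg := mg _ _ (reg_coord i).
rewrite preimage_setT in rf rg.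
have := regV (regD rf (regM (reg_cst (-1) (opnT T)) rg)).
move=> /reg_opn oD; eexists; split; [exact: oD| |].
  by split=> //=; rewrite mulN1r subr_eq0.
move=> s [_ /=]; rewrite mulN1r subr_eq0 => fgs fgE.
by move: fgs; rewrite fgE eqxx.
Qed.

(** The affine space A^n, with points the sequences of length n. *)

Definition An_pts (n : nat) : set (seq k) := [set s | size s = n].

Definition An_coords n (s : {s | An_pts n s}) : affine 'rV[k]_n :=
  \row_i (sval s)`_i.

Definition An_point n (v : affine 'rV[k]_n) : {s | An_pts n s} :=
  exist _ (codom ((v : 'rV[k]_n) ord0))
    (etrans (size_codom _) (card_ord n)).

Lemma An_coordsK n : cancel (@An_coords n) (@An_point n).
Proof.
move=> [s sn]; apply: eq_exist => /=; have sn' : size s = n := sn.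
apply: (@eq_from_nth _ 0) => [|i]; rewrite size_codom card_ord ?sn' // => ni.
rewrite (nth_map (Ordinal ni)) ?size_enum_ord // mxE.
by rewrite nth_enum_ord.
Qed.

Lemma An_pointK n : cancel (@An_point n) (@An_coords n).
Proof.
move=> v; apply/rowP => i; rewrite mxE /= (nth_map i) ?size_enum_ord //.
by rewrite nth_ord_enum.
Qed.

Definition An_on n : space_on k {s | An_pts n s} := induced_on (@An_coords n).

Lemma An_separated n : separated (Space (An_on n)).
Proof.
move=> T f g mf mg.
have mi : morphism (@An_coords n : Space (An_on n) -> _).
  exact: induced_morphism.
have := affine_separated (morphism_comp mf mi) (morphism_comp mg mi).
congr (clsd _); apply/seteqP; split=> t /= => [|->//].
exact: (can_inj (@An_coordsK n)).
Qed.

Lemma An_prevariety n : is_prevariety (Space (An_on n)).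
Proof.
exists 1%N, (fun=> setT); split=> [_|x]; last by exists ord0.
split; first exact: opnT.
exists 'rV[k]_n, setT; split.
  rewrite /clsd setCT.
  have -> : set0 = \bigcup_(U in set0) U :> set (affine 'rV[k]_n).
    by rewrite bigcup_set0.
  by apply: opn_bigcup.
pose f (x : subspace [set: Space (An_on n)]) :
  subspace [set: affine 'rV[k]_n] := exist _ (An_coords (sval x)) I.
pose g (y : subspace [set: affine 'rV[k]_n]) :
  subspace [set: Space (An_on n)] := exist _ (An_point (sval y)) I.
exists f, g; split.
- apply: morphism_induced.
  exact: (@morphism_comp _ (subspace [set: Space (An_on n)])
    (Space (An_on n)) (affine 'rV[k]_n) sval (@An_coords n)
    (induced_morphism _) (induced_morphism _)).
- apply: morphism_induced; apply: morphism_induced.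
  rewrite (_ : _ \o _ = sval); first exact: induced_morphism.
  by apply/funext => y /=; rewrite An_pointK.
- by move=> [x []]; apply: eq_exist; rewrite /= An_coordsK.
- by move=> [y []]; apply: eq_exist; rewrite /= An_pointK.
Qed.

Definition An n : variety := Variety (@An_prevariety n) (@An_separated n).

(** * The Grothendieck ring of varieties and its localization *)

(* [X] depends only on the isomorphism class, [X] = [Z] + [X \ Z] for Z closed
   in X, [X x Y] = [X] [Y], and the point has class 1. *)
Inductive k0_rel : rterm variety -> rterm variety -> Prop :=
| k0_iso (X Y : variety) : isomorphic X Y -> k0_rel (TGen X) (TGen Y)
| k0_scissor (X Z U : variety) (S : set X) :
    clsd S -> isomorphic Z (subspace S) -> isomorphic U (subspace (~` S)) ->
    k0_rel (TGen X) (TAdd (TGen Z) (TGen U))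
| k0_prod (X Y P : variety) (p : P -> X) (q : P -> Y) :
    is_product p q -> k0_rel (TGen P) (TMul (TGen X) (TGen Y))
| k0_point : k0_rel (TGen (An 0)) TOne.

Definition K0Var : comPzRingType := presented_ring k0_rel.

Definition k0_class (X : variety) : K0Var := rgen k0_rel X.

Definition k0_lefschetz : K0Var := k0_class (An 1).

(* K_0(Var)[L^-1, (1 - L^i)^-1 : i >= 1] *)
Definition K0loc : comPzRingType :=
  localization [set s | s = k0_lefschetz \/
    exists2 i : nat, (1 <= i)%N & s = 1 - k0_lefschetz ^+ i].

Definition motive (X : variety) : K0loc := to_loc _ (k0_class X).

Definition lefschetz : K0loc := motive (An 1).

Lemma lefschetz_uinv : lefschetz * uinv lefschetz = 1.
Proof.
have [|u Lu] := @to_loc_inv K0Var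
  [set s | s = k0_lefschetz \/
    exists2 i : nat, (1 <= i)%N & s = 1 - k0_lefschetz ^+ i] k0_lefschetz.
  by left.
exact: uinvP Lu.
Qed.

Lemma one_sub_lefschetzX_uinv i : (1 <= i)%N ->
  (1 - lefschetz ^+ i) * uinv (1 - lefschetz ^+ i) = 1.
Proof.
move=> i1; have [|u Lu] := @to_loc_inv K0Var
  [set s | s = k0_lefschetz \/
    exists2 i : nat, (1 <= i)%N & s = 1 - k0_lefschetz ^+ i]
  (1 - k0_lefschetz ^+ i).
  by right; exists i.
by apply: uinvP; move: Lu; rewrite rmorphB rmorphXn rmorph1; exact.
Qed.

End Varieties.

Definition qpochhammer (A : comPzRingType) (a q : A) (n : nat) : A :=
  \prod_(i < n) (1 - a * q ^+ i).

(** * Geometric quotients *)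

(* [orb] is the orbit relation of a group acting on X: the fibres of p are the
   orbits, Y has the quotient topology, and the regular functions on U are the
   invariant regular functions on its preimage. *)
Record geometric_quotient (k : closedFieldType) (X Y : space k)
    (orb : X -> X -> Prop) (p : X -> Y) : Prop := GeometricQuotient {
  gq_surj : forall y, exists x, p x = y;
  gq_fibre : forall x x', p x = p x' <-> orb x x';
  gq_opn : forall U : set Y, opn U <-> opn (p @^-1` U);
  gq_reg : forall (U : set Y) (f : Y -> k),
    reg U f <-> reg (p @^-1` U) (f \o p)
}.

(** * Tuples of strictly flag-lowering operators with a cyclic vector *)

Section FlagOperators.
Variables (k : closedFieldType) (m d : nat).

(* End(V)^m x V for V = k^d *)
Definition opvec : vectType k := ({ffun 'I_m -> 'M[k]_d} * 'cV[k]_d)%type.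

(* The algebra k<phi_1, ..., phi_m> inside End(V). *)
Inductive gen_alg (phi : 'I_m -> 'M[k]_d) : 'M[k]_d -> Prop :=
| gen_alg_scalar c : gen_alg phi c%:M
| gen_alg_gen i : gen_alg phi (phi i)
| gen_alg_add a b : gen_alg phi a -> gen_alg phi b -> gen_alg phi (a + b)
| gen_alg_mul a b : gen_alg phi a -> gen_alg phi b -> gen_alg phi (a *m b).

Definition stable (x : opvec) : Prop :=
  forall w : 'cV[k]_d, exists2 a, gen_alg x.1 a & a *m x.2 = w.

Definition act (g : 'M[k]_d) (x : opvec) : opvec :=
  ([ffun i => g *m x.1 i *m invmx g], g *m x.2).

(* Only F 0, ..., F d are meaningful; F d = V follows from its dimension. *)
Definition complete_flag (F : nat -> {vspace 'cV[k]_d}) : Prop :=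
  (forall i, (i <= d)%N -> \dim (F i) = i) /\
  (forall i, (i < d)%N -> (F i <= F i.+1)%VS).

Definition borel (F : nat -> {vspace 'cV[k]_d}) (g : 'M[k]_d) : Prop :=
  g \in unitmx /\
  forall i (x : 'cV[k]_d), (i <= d)%N -> (g *m x \in F i) = (x \in F i).

Definition flag_nilp (F : nat -> {vspace 'cV[k]_d}) (phi : 'M[k]_d) : Prop :=
  forall i (x : 'cV[k]_d), (i < d)%N -> x \in F i.+1 -> phi *m x \in F i.

(* (n(V)^m x V)_st *)
Definition stable_nilp (F : nat -> {vspace 'cV[k]_d}) : space k :=
  subspace ([set x : affine opvec |
    (forall i, flag_nilp F ((x : opvec).1 i)) /\ stable x]).

Definition borel_orbit (F : nat -> {vspace 'cV[k]_d})
    (x y : stable_nilp F) : Prop :=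
  exists2 g, borel F g & act g (sval x) = sval y.

End FlagOperators.

(* Main.v *)
(* In a basis e_0, ..., e_(d-1) adapted to the flag, a stable point consists of
   the vectors v and phi_i e_j, where phi_i e_j involves only the e_l with l > j.
   Only the m l + 1 vectors v and phi_i e_j with j < l can have a nonzero
   e_l-coordinate, and stability allows one to choose, for l = 0, ..., d-1, one
   of them as l-th pivot: replacing e_l by the part of the pivot along
   e_l, ..., e_(d-1), the pivot loses its coordinates beyond e_l. So l of the
   m l + 1 vectors are earlier pivots without e_l-coordinate, and (m-1) l + 1
   candidates remain. Once all pivots are fixed, each Borel orbit has at most one
   normal form, whose coordinates are invariant regular functions; hence the
   orbits with these pivots form an open chart of the quotient. Taking always the
   first candidate with nonzero coordinate cuts the quotient into affine cells,
   and the choice of the l-th pivot leaves j free coordinates, where j runs over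
   0, ..., (m-1) l. Therefore [Z] is the product over l of
   1 + L + ... + L^((m-1) l). *)

Require Import Defs.
From HB Require Import structures.
From mathcomp Require Import all_boot all_order all_algebra.
From mathcomp Require Import boolp classical_sets.
From mathcomp Require mpoly.
From mathcomp Require Import reals complex.
(* The library vector redefines [space]. *)
Import Defs.

Set Implicit Arguments.
Unset Strict Implicit.
Unset Printing Implicit Defensive.

Import GRing.Theory.
Local Open Scope ring_scope.


(** * Isomorphisms and classes of closed subsets *)

Section Isomorphism.
Local Open Scope classical_set_scope.
Variable k : closedFieldType.
Implicit Types X Y Z : space k.

Lemma isomorphic_sym X Y : isomorphic X Y -> isomorphic Y X.
Proof. by move=> [f [g [mf mg fK gK]]]; exists g, f. Qed.

Lemma isomorphic_trans X Y Z :
  isomorphic X Y -> isomorphic Y Z -> isomorphic X Z.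
Proof.
move=> [f [g [mf mg fK gK]]] [f' [g' [mf' mg' fK' gK']]].
exists (f' \o f), (g \o g'); split.
- exact: morphism_comp.
- exact: morphism_comp.
- by move=> x; rewrite /= fK' fK.
- by move=> x; rewrite /= gK gK'.
Qed.

Lemma sval_morphism X (S : set X) : morphism (sval : subspace S -> X).
Proof. exact: induced_morphism. Qed.

Lemma isomorphic_subspace X Y (f : X -> Y) (g : Y -> X) (S : set X) :
  morphism f -> morphism g -> cancel f g -> cancel g f ->
  isomorphic (subspace S) (subspace (g @^-1` S)).
Proof.
move=> mf mg fK gK.
have Sf (x : subspace S) : (g @^-1` S) (f (sval x)).
  by rewrite /preimage /= fK; exact: svalP.
exists (fun x => exist _ (f (sval x)) (Sf x)).
exists (fun y : subspace (g @^-1` S) => exist _ (g (sval y)) (svalP y)).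
split.
- apply: morphism_induced.
  exact: morphism_comp (@sval_morphism _ _) mf.
- apply: morphism_induced.
  exact: morphism_comp (@sval_morphism _ _) mg.
- by move=> [x Sx]; apply: eq_exist => /=.
- by move=> [x Sx]; apply: eq_exist => /=.
Qed.

Lemma isomorphic_subsubspace X (S : set X) (A : set (subspace S)) (B : set X) :
  (forall x, A x <-> B (sval x)) -> B `<=` S ->
  isomorphic (subspace A) (subspace B).
Proof.
move=> AB BS.
have fB (x : subspace A) : B (sval (sval x)) by apply/AB; exact: svalP.
have gA (y : subspace B) : A (exist _ (sval y) (BS _ (svalP y))).
  by apply/AB; exact: (svalP y).
exists (fun x => exist _ (sval (sval x)) (fB x)).
exists (fun y => exist _ (exist _ (sval y) (BS _ (svalP y))) (gA y)).
split.
- apply: morphism_induced.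
  exact: morphism_comp (@sval_morphism _ A) (@sval_morphism _ S).
- apply: morphism_induced; apply: morphism_induced.
  exact: (@sval_morphism _ B).
- by move=> [[x Sx] Ax]; apply: eq_exist; apply: eq_exist.
- by move=> [x Bx]; apply: eq_exist.
Qed.

(** An isomorphism onto a subspace becomes a map to the ambient space, along which subsets of [Y]
    inside [T] can be pulled back to [X] directly. *)
Lemma isomorphic_restrict X Y (T : set Y) : isomorphic X (subspace T) ->
  exists f : X -> Y, [/\ morphism f, forall x, T (f x) & forall B, B `<=` T ->
    isomorphic (subspace (f @^-1` B)) (subspace B)].
Proof.
move=> [f [g [mf mg fK gK]]].
exists (fun x => sval (f x)); split=> [|x|B BT].
- exact: morphism_comp mf (@sval_morphism _ T).
- exact: svalP.
apply: isomorphic_trans (isomorphic_subspace _ mf mg fK gK) _.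
by apply: isomorphic_subsubspace => // y; rewrite /preimage /= gK.
Qed.

Lemma clsd_preimage X Y (f : X -> Y) (S : set Y) :
  morphism f -> clsd S -> clsd (f @^-1` S).
Proof. by move=> [of_ _] cS; exact: (of_ _ cS). Qed.

Lemma opn0 X : opn (set0 : set X).
Proof.
have -> : set0 = \bigcup_(U in set0) U :> set X by rewrite bigcup_set0.
exact: opn_bigcup.
Qed.

Lemma opnU X (U V : set X) : opn U -> opn V -> opn (U `|` V).
Proof.
move=> oU oV; apply: opn_local => x [Ux|Vx].
  by exists U; split=> //; left.
by exists V; split=> //; right.
Qed.

Lemma clsdT X : clsd ([set: X]).
Proof. by rewrite /clsd setCT; exact: opn0. Qed.

Lemma clsdD X (S E : set X) : clsd S -> opn E -> clsd (S `\` E).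
Proof. by move=> cS oE; rewrite /clsd setDE setCI setCK; exact: opnU. Qed.

Lemma clsd_subsubspace X (S : set X) (A : set (subspace S)) :
  clsd S -> clsd A -> clsd [set x | exists2 y, A y & sval y = x].
Proof.
move=> cS [V oV AV].
have -> : [set x | exists2 y, A y & sval y = x] = S `\` V.
  apply/seteqP; split=> [x [y Ay <-]|x [Sx nVx]].
    split; first exact: svalP.
    move=> Vy; have : (~` A) y by rewrite AV.
    by [].
  exists (exist _ x Sx) => //; apply: contrapT => nA.
  by have : (~` A) (exist _ x Sx) by []; rewrite AV.
exact: clsdD.
Qed.

End Isomorphism.

Section ClosedSubvariety.
Local Open Scope classical_set_scope.
Variables (k : closedFieldType) (X : variety k) (S : set X).
Hypothesis cS : clsd S.

(** The points of a [variety] are sequences over [k], so [S] is re-encoded by the sequences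
    underlying its points; [incl] recovers the points of [X]. *)
Let pts : set (seq k) := [set s | exists x : X, S x /\ sval x = s].

Let incl (s : {s | pts s}) : X := sval (cid (svalP s)).

Let inclP s : S (incl s). Proof. by have [] := svalP (cid (svalP s)). Qed.

Let sval_incl s : sval (incl s) = sval s.
Proof. by have [] := svalP (cid (svalP s)). Qed.

Let incl_inj : injective incl.
Proof.
move=> s t st; have := sval_incl s; rewrite st sval_incl.
by case: s t {st} => [s hs] [t ht] /= ts; apply: eq_exist.
Qed.

Let Y := Space (induced_on incl).

Let Y_iso : exists (f : Y -> subspace S) (g : subspace S -> Y),
  [/\ morphism f, morphism g, cancel f g, cancel g f &
      forall x, incl (g x) = sval x].
Proof.
have gP (x : subspace S) : pts (sval (sval x)).
  by exists (sval x); split=> //; exact: svalP.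
pose g (x : subspace S) : Y := exist _ (sval (sval x)) (gP x).
have incl_g x : incl (g x) = sval x.
  have := sval_incl (g x).
  rewrite /=; case: (incl _) (sval x) => [a ha] [b hb] /= ab.
  exact: eq_exist.
exists (fun y => exist _ (incl y) (inclP y)), g; split=> //.
- apply: morphism_induced; exact: induced_morphism.
- apply: morphism_induced.
  by rewrite (_ : _ \o _ = sval); [exact: sval_morphism|exact/funext].
- by move=> y; apply: incl_inj; rewrite incl_g.
- by move=> [x Sx]; apply: eq_exist; rewrite incl_g.
Qed.

(** Each affine chart of [X] meets [S] in a closed subset, which the chart isomorphism carries to a
    closed subset of a vector space. Separatedness passes along the injective morphism [incl]. *)
Lemma clsd_subvariety : exists Y : variety k, isomorphic Y (subspace S).
Proof.
have [u [v [mu mv uK vK iv]]] := Y_iso.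
have preY : is_prevariety Y.
  have [n [U [Ua Ucov]]] := var_prevariety X.
  exists n, (fun i => incl @^-1` U i); split=> [i|y]; last exact: Ucov.
  have [oU [W [A [cA [f [g [mf mg fK gK]]]]]]] := Ua i.
  split; first by exists (U i).
  pose B : set (subspace (U i)) := [set x | S (sval x)].
  have cB : clsd B by exact: clsd_preimage (@sval_morphism _ _ _) cS.
  have cgB : clsd (g @^-1` B) by exact: clsd_preimage mg cB.
  pose A' := [set x | exists2 y, (g @^-1` B) y & sval y = x].
  exists W, A'.
  split; first exact: clsd_subsubspace.
  apply: isomorphic_trans; last first.
    apply: (@isomorphic_subsubspace _ _ A (g @^-1` B) A') => x; last first.
      by move=> [y _ <-]; exact: svalP.
     split=> [Bx|[y By]]; first by exists x.
    case: x y By => [x hx] [y hy] By /= yx; subst.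
    by rewrite (Prop_irrelevance hx hy).
  apply: isomorphic_trans (isomorphic_subspace B mf mg fK gK).
  apply: isomorphic_trans; first exact: isomorphic_subspace mu mv uK vK.
  apply: (@isomorphic_trans _ _ (subspace (S `&` U i))).
    apply: isomorphic_subsubspace => [x|x []//].
    by rewrite /preimage /= iv; split=> [?|[]//]; split=> //; exact: svalP.
  apply: isomorphic_sym; apply: isomorphic_subsubspace => [x|x []//].
  by split=> [?|[]//]; split=> //; exact: svalP.
have sepY : separated Y.
  move=> T f g mf mg.
  have mi : morphism (incl : Y -> X) by exact: induced_morphism.
  have := var_separated (morphism_comp mf mi) (morphism_comp mg mi).
  congr (clsd _); apply/seteqP; split=> t /= => [|->//].
  exact: incl_inj.
by exists (Variety preY sepY), u, v.
Qed.

End ClosedSubvariety.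

Section Class.
Local Open Scope classical_set_scope.
Variable k : closedFieldType.
Implicit Types X Y Z U P : variety k.

Lemma k0_class_iso X Y : isomorphic X Y -> k0_class X = k0_class Y.
Proof. by move=> XY; apply/rclass_eq/rcong_rel/k0_iso. Qed.

Lemma k0_class_scissor X Z U (S : set X) :
  clsd S -> isomorphic Z (subspace S) -> isomorphic U (subspace (~` S)) ->
  k0_class X = k0_class Z + k0_class U.
Proof.
move=> cS ZS US; rewrite /k0_class /rgen -rclass_add.
by apply/rclass_eq/rcong_rel; exact: k0_scissor cS ZS US.
Qed.

Lemma k0_class_prod X Y P (p : P -> X) (q : P -> Y) :
  is_product p q -> k0_class P = k0_class X * k0_class Y.
Proof.
move=> pq; rewrite /k0_class /rgen -rclass_mul.
by apply/rclass_eq/rcong_rel; exact: k0_prod pq.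
Qed.

(* Junk value 0 when S is not closed. *)
Definition clsd_class X (S : set X) : K0Var k :=
  if pselect (clsd S) is left cS then k0_class (sval (cid (clsd_subvariety cS)))
  else 0.

Lemma clsd_classE X (S : set X) Y :
  clsd S -> isomorphic Y (subspace S) -> clsd_class S = k0_class Y.
Proof.
move=> cS YS; rewrite /clsd_class; case: pselect => // cS'.
have ZS := svalP (cid (clsd_subvariety cS')).
exact/k0_class_iso/(isomorphic_trans ZS)/isomorphic_sym.
Qed.

Lemma clsd_classT X : clsd_class [set: X] = k0_class X.
Proof.
apply: clsd_classE; first exact: clsdT.
exists (fun x => exist _ x I), sval; split=> //.
- exact: morphism_induced.
- exact: sval_morphism.
- by move=> [x []].
Qed.

(** The scissor relation needs a variety as ambient space, so the decomposition of [S] is pulled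
    back to a variety isomorphic to [S]. *)
Lemma clsd_classD X (S E : set X) U : clsd S -> opn E ->
  isomorphic U (subspace (S `&` E)) ->
  clsd_class S = clsd_class (S `\` E) + k0_class U.
Proof.
move=> cS oE US; have cSE := clsdD cS oE.
have [Y YS] := clsd_subvariety cS; have [Z ZS] := clsd_subvariety cSE.
rewrite (clsd_classE cS YS) (clsd_classE cSE ZS).
have [f [mf fS fE]] := isomorphic_restrict YS.
apply: (@k0_class_scissor _ _ _ (f @^-1` (S `\` E))).
- exact: clsd_preimage mf cSE.
- by apply: isomorphic_trans ZS (isomorphic_sym (fE _ _)) => x [].
- rewrite (_ : ~` _ = f @^-1` (S `&` E)).
    by apply: isomorphic_trans US (isomorphic_sym (fE _ _)) => x [].
  apply/seteqP; split=> x /=; last by move=> [_ Ex] [].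
  by move=> nSE; split=> //; apply: contrapT => nE; apply: nSE.
Qed.

Lemma clsd_class0 X : clsd_class (set0 : set X) = 0.
Proof.
have c0 : clsd (set0 : set X) by rewrite /clsd setC0; exact: opnT.
have [Y Y0] := clsd_subvariety c0.
(* For the empty set the scissor relation reads c = c + [Y], with [Y] itself empty; cancelling gives
   [Y] = 0. *)
have := clsd_classD (U := Y) c0 (opnT X); rewrite set0I set0D => /(_ Y0).
by rewrite -{1}[clsd_class _]addr0 => /addrI; rewrite (clsd_classE c0 Y0).
Qed.

End Class.


(** * Regular functions and affine spaces *)

Section Regular.
Local Open Scope classical_set_scope.
Variables (k : closedFieldType) (X : space k).
Implicit Types U V : set X.

Lemma reg_sum U (I : Type) (r : seq I) (P : pred I) (f : I -> X -> k) :
  opn U -> (forall i, P i -> reg U (f i)) ->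
  reg U (fun x => \sum_(i <- r | P i) f i x).
Proof.
move=> oU rf; elim: r => [|i r IHr].
  by apply: reg_eq (reg_cst 0 oU) _ => x _; rewrite big_nil.
case Pi: (P i); last by apply: reg_eq IHr _ => x _; rewrite big_cons Pi.
by apply: reg_eq (regD (rf i Pi) IHr) _ => x _; rewrite big_cons Pi.
Qed.

Lemma reg_prod U (I : Type) (r : seq I) (P : pred I) (f : I -> X -> k) :
  opn U -> (forall i, P i -> reg U (f i)) ->
  reg U (fun x => \prod_(i <- r | P i) f i x).
Proof.
move=> oU rf; elim: r => [|i r IHr].
  by apply: reg_eq (reg_cst 1 oU) _ => x _; rewrite big_nil.
case Pi: (P i); last by apply: reg_eq IHr _ => x _; rewrite big_cons Pi.
by apply: reg_eq (regM (rf i Pi) IHr) _ => x _; rewrite big_cons Pi.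
Qed.

Lemma regX U (f : X -> k) n : reg U f -> reg U (fun x => f x ^+ n).
Proof.
move=> rf; elim: n => [|n IHn].
  by apply: reg_eq (reg_cst 1 (reg_opn rf)) _ => x _; rewrite expr0.
by apply: reg_eq (regM rf IHn) _ => x _; rewrite exprS.
Qed.

Lemma reg_morphism (Y : space k) (f : X -> Y) (g : Y -> k) :
  morphism f -> reg setT g -> reg setT (g \o f).
Proof. by move=> [_ mf] /mf. Qed.

Lemma opn_neq0 U (f : X -> k) : reg U f -> opn (U `&` [set x | f x != 0]).
Proof. by move=> /regV /reg_opn. Qed.

(** Polynomials in regular functions are regular. This suffices: open sets of [affine W] are unions
    of loci where a polynomial is nonzero, and regular functions are locally quotients of
    polynomials. *)
Lemma morphism_affine (W : vectType k) (f : X -> affine W) :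
  (forall i, reg setT (fun x => coord (vbasis {:W}) i (f x : W))) ->
  morphism f.
Proof.
move=> rf; have rP P : reg setT (fun x => @peval k W P (f x)).
  have rs : reg setT (fun x => \sum_(m <- mpoly.msupp P)
      mpoly.mcoeff m P *
      \prod_i coord (vbasis {:W}) i (f x : W) ^+ mpoly.fun_of_multinom m i).
    apply: reg_sum => [|m _]; first exact: opnT.
    apply: regM; first exact: reg_cst (opnT _).
    by apply: reg_prod => [|i _]; [exact: opnT|exact: regX].
  by apply: reg_eq rs _ => x _; rewrite /peval mpoly.mevalE.
have of_ (U : set (affine W)) : opn U -> opn (f @^-1` U).
  move=> /aff_opnP oU; apply: opn_local => x /oU [P [Px PU]].
  exists (setT `&` [set x | peval P (f x) != 0]); split=> //.
    exact: opn_neq0.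
  by move=> y [_ /PU].
split=> // U g [oU rg]; apply: reg_glue => [|x Ux]; first exact: of_.
have [P [Q [Qx gPQ]]] := rg _ Ux.
pose V := f @^-1` U `&` [set x | peval Q (f x) != 0].
have oV : opn V.
  have := opnI (of_ _ oU) (opn_neq0 (rP Q)).
  by rewrite setTI.
exists V; split=> [//|y []//|].
apply: (@reg_eq _ _ _ (fun x => peval P (f x) * (peval Q (f x))^-1)).
  apply: regM; first exact: reg_sub (rP P) oV _.
  by apply: reg_sub (regV (rP Q)) oV _ => y [].
by move=> y [Uy Qy] /=; rewrite gPQ.
Qed.

End Regular.

Section LinearRegular.
Local Open Scope classical_set_scope.
Variables (k : closedFieldType) (W : vectType k).

Lemma reg_linear (f : {scalar W}) : reg (X := affine W) setT f.
Proof.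
apply: (@reg_eq _ (affine W) _ (fun w : affine W =>
    \sum_i coord (vbasis {:W}) i w * f (vbasis {:W})`_i)).
  apply: reg_sum => [|i _]; first exact: opnT.
  by apply: regM; [exact: reg_coord|exact: reg_cst (opnT _)].
move=> w _; rewrite [in RHS](coord_vbasis (memvf (w : W))) linear_sum.
by apply: eq_bigr => i _; rewrite linearZ.
Qed.

End LinearRegular.

Section AffineSpace.
Local Open Scope classical_set_scope.
Variable k : closedFieldType.

Lemma morphism_An (T : space k) n (f : T -> An k n) :
  (forall i, (i < n)%N -> reg setT (fun t => (sval (f t))`_i)) -> morphism f.
Proof.
move=> rf; apply: morphism_induced; apply: morphism_affine => i.
(* The structure of [affine] is defined through [vbasis], whose coordinates are constant linear
   combinations of the entries of the row. *)
apply: (@reg_eq _ _ _ (fun t => \sum_j (sval (f t))`_(val j) *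
    coord (vbasis {:'rV[k]_n}) i (delta_mx 0 j))).
  apply: reg_sum => [|j _]; first exact: opnT.
  by apply: regM; [exact: rf (ltn_ord j)|exact: reg_cst (opnT _)].
move=> t _ /=; rewrite (row_sum_delta (An_coords (f t) : 'rV_n)) linear_sum.
by apply: eq_bigr => j _; rewrite linearZ /= mxE.
Qed.

Lemma reg_An n i : (i < n)%N -> reg setT (fun s : An k n => (sval s)`_i).
Proof.
move=> ni; pose f (v : 'rV[k]_n) := v ord0 (Ordinal ni).
have lf : scalar f by move=> a u v; rewrite /f !mxE.
pose fL : {scalar 'rV[k]_n} := HB.pack f (GRing.isLinear.Build _ _ _ _ f lf).
have := reg_morphism (induced_morphism (@An_coords k n)) (reg_linear fL).
by move/reg_eq; apply => s _ /=; rewrite /f mxE.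
Qed.

Lemma size_An n (s : An k n) : size (sval s) = n.
Proof. exact: (svalP s). Qed.

Lemma An_inj n (s t : An k n) : sval s = sval t -> s = t.
Proof. by case: s t => [s hs] [t ht] /= st; exact: eq_exist. Qed.

Definition An_head n (s : An k n.+1) : An k 1 :=
  exist _ [:: (sval s)`_0] (erefl 1%N).

Lemma An_behead_subproof n (s : An k n.+1) : size (behead (sval s)) = n.
Proof. by rewrite size_behead size_An. Qed.

Definition An_behead n (s : An k n.+1) : An k n :=
  exist _ (behead (sval s)) (An_behead_subproof s).

Lemma An_cons_subproof n (a : An k 1) (s : An k n) :
  size ((sval a)`_0 :: sval s) = n.+1.
Proof. by rewrite /= size_An. Qed.

Definition An_cons n (a : An k 1) (s : An k n) : An k n.+1 :=
  exist _ ((sval a)`_0 :: sval s) (An_cons_subproof a s).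

Lemma An_product n : is_product (@An_head n) (@An_behead n).
Proof.
split=> [||T f g mf mg].
- by apply: morphism_An => -[|//] _; exact: reg_An.
- apply: morphism_An => i ni.
  apply: reg_eq (reg_An (n := n.+1) (i := i.+1) ni) _ => s _.
  by rewrite nth_behead.
exists (fun t => An_cons (f t) (g t)); split; first split.
- apply: morphism_An => -[|i] ni /=.
    exact: (reg_morphism mf (reg_An (ltnSn 0))).
  exact: (reg_morphism mg (@reg_An n i ni)).
- apply/funext => t; apply: An_inj => /=.
  by have := size_An (f t); case: (sval (f t)) => [|a []].
- by apply/funext => t; apply: An_inj.
move=> h [mh hf hg]; apply/funext => t; apply: An_inj => /=.
by rewrite -hf -hg /=; have := size_An (h t); case: (sval (h t)).
Qed.

Lemma k0_class_An n : k0_class (An k n) = k0_lefschetz k ^+ n.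
Proof.
elim: n => [|n IHn]; first by apply/rclass_eq/rcong_rel/k0_point.
by rewrite (k0_class_prod (An_product n)) IHn exprS.
Qed.

End AffineSpace.


(** * Normal forms of cyclic tuples under the Borel group *)

Section NormalForms.
Variables (k : closedFieldType) (m d : nat).
Local Notation K := (option ('I_m * 'I_d)).
Local Notation basis l := (delta_mx l 0 : 'cV[k]_d).
Implicit Types (x y : opvec k m d) (b : 'M[k]_d) (c : K) (p : seq K).

(* The pair (phi, v) is stored as the family of vectors v and phi_i e_j,
   indexed by K. *)
Definition opcol x c : 'cV[k]_d :=
  if c is Some (i, j) then col j (x.1 i) else x.2.

Definition entry x c (l : 'I_d) : k := opcol x c l 0.

(** This is the first row in which column [c] may be nonzero, as phi_i e_j involves only e_l with l
    > j. *)
Definition height c : nat := if c is Some (_, j) then j.+1 else 0.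

Definition lower x := forall c (l : 'I_d), (l < height c)%N -> entry x c l = 0.

(** This is the Borel group in adapted coordinates; with triangularity of the inverse built in,
    closure under inversion is immediate. *)
Definition ltri b : bool :=
  [&& b \in unitmx, is_trig_mx b & is_trig_mx (invmx b)].

(* The l-th pivot column p_l is e_l plus a combination of the e_r with r < l. *)
Definition normal p x := forall l : 'I_d, (l < size p)%N ->
  entry x (nth None p l) l = 1 /\
  forall r : 'I_d, (l < r)%N -> entry x (nth None p l) r = 0.

Lemma opvec_eqP x y : (forall c l, entry x c l = entry y c l) -> x = y.
Proof.
case: x y => [f v] [g w] xy; congr (_, _).
  apply/ffunP => i; apply/matrixP => l j.
  by have := xy (Some (i, j)) l; rewrite /entry /= !mxE.
by apply/colP => l; exact: (xy None l).
Qed.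

Definition opvec_of (f : K -> 'I_d -> k) : opvec k m d :=
  ([ffun i => \matrix_(l, j) f (Some (i, j)) l], \col_l f None l).

Lemma entry_opvec_of f c l : entry (opvec_of f) c l = f c l.
Proof. by case: c => [[i j]|]; rewrite /entry /= ?ffunE !mxE. Qed.

Definition coordinate c l x : k := entry x c l.

Fact coordinate_is_scalar c l : scalar (coordinate c l).
Proof.
by move=> a x y; case: c => [[i j]|]; rewrite /coordinate /entry /= ?ffunE !mxE.
Qed.

HB.instance Definition _ c l :=
  GRing.isLinear.Build k (opvec k m d) k *%R (coordinate c l)
    (coordinate_is_scalar c l).

Lemma opvec_sum_entry x : x = \sum_c \sum_l entry x c l *:
  opvec_of (fun e r => ((e == c) && (r == l))%:R).
Proof.
apply: opvec_eqP => e r; rewrite -[RHS]/(coordinate e r _) linear_sum.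
rewrite (bigD1 e) //= [X in _ + X]big1 => [|c ce].
  rewrite addr0 linear_sum (bigD1 r) //= [X in _ + X]big1 => [|l lr].
    by rewrite linearZ /= [coordinate _ _ _]entry_opvec_of !eqxx mulr1 addr0.
  rewrite linearZ /= [coordinate _ _ _]entry_opvec_of eqxx eq_sym.
  by rewrite (negPf lr) mulr0.
rewrite linear_sum big1 //= => l _.
by rewrite linearZ /= [coordinate _ _ _]entry_opvec_of eq_sym (negPf ce) mulr0.
Qed.

Lemma invmxM (g h : 'M[k]_d) : g \in unitmx -> h \in unitmx ->
  invmx (g *m h) = invmx h *m invmx g.
Proof.
move=> ug uh; have ugh : g *m h \in unitmx by rewrite unitmx_mul ug.
apply: (can_inj (mulKmx ugh)).
by rewrite mulmxV // mulmxA mulmxK // mulmxV.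
Qed.

Lemma actM (g h : 'M[k]_d) x : g \in unitmx -> h \in unitmx ->
  act (g *m h) x = act g (act h x).
Proof.
move=> ug uh; congr (_, _); last by rewrite mulmxA.
by apply/ffunP => i; rewrite !ffunE invmxM // !mulmxA.
Qed.

Lemma act1 x : act 1%:M x = x.
Proof.
case: x => f v; congr (_, _); last by rewrite mul1mx.
by apply/ffunP => i; rewrite !ffunE /= invmx1 mul1mx mulmx1.
Qed.

Lemma actK (g : 'M[k]_d) x : g \in unitmx -> act (invmx g) (act g x) = x.
Proof. by move=> ug; rewrite -actM ?unitmx_inv // mulVmx // act1. Qed.

Lemma actVK (g : 'M[k]_d) x : g \in unitmx -> act g (act (invmx g) x) = x.
Proof. by move=> ug; rewrite -actM ?unitmx_inv // mulmxV // act1. Qed.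

Lemma trig_mxM (A B : 'M[k]_d) : is_trig_mx A -> is_trig_mx B ->
  is_trig_mx (A *m B).
Proof.
move=> /is_trig_mxP tA /is_trig_mxP tB; apply/is_trig_mxP => i j ij.
rewrite mxE big1 // => r _.
have [ir|ri] := ltnP i r; first by rewrite tA ?mul0r.
by rewrite tB ?mulr0 // (leq_ltn_trans ri ij).
Qed.

Lemma ltri1 : ltri 1%:M.
Proof. by rewrite /ltri invmx1 unitmx1 andbb; exact: scalar_mx_is_trig. Qed.

Lemma ltriV b : ltri b -> ltri (invmx b).
Proof. by case/and3P=> ub tb tb'; rewrite /ltri unitmx_inv ub tb' invmxK. Qed.

Lemma ltriM b b' : ltri b -> ltri b' -> ltri (b *m b').
Proof.
move=> /and3P[ub tb tb'] /and3P[uc tc tc'].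
by rewrite /ltri unitmx_mul ub uc invmxM // !trig_mxM.
Qed.

Lemma ltri_diag b l : ltri b -> b l l != 0.
Proof.
move=> /and3P[ub /is_trig_mxP tb /is_trig_mxP tb'].
apply/eqP => b0; have /matrixP/(_ l l) := mulmxV ub.
rewrite !mxE eqxx big1 => [/eqP|r _]; first by rewrite eq_sym oner_eq0.
case: (ltngtP l r) => [lr|rl|/val_inj <-]; last by rewrite b0 mul0r.
  by rewrite tb ?mul0r.
by rewrite tb' ?mulr0.
Qed.

Lemma lower_act b x : ltri b -> lower x -> lower (act b x).
Proof.
move=> /and3P[ub /is_trig_mxP tb /is_trig_mxP tb'] lx [[i j]|//] l lj.
rewrite /entry /= ffunE !mxE big1 // => r _.
have [rj|jr] := ltnP r j; first by rewrite tb' ?mulr0.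
rewrite mxE big1 ?mul0r // => s _.
have [ls|sl] := ltnP l s; first by rewrite tb ?mul0r.
have := lx (Some (i, r)) s; rewrite /entry /= !mxE => -> //; rewrite ?mulr0 //.
by rewrite ltnS (leq_trans sl) // (leq_trans _ jr).
Qed.

(** Column phi_i e_j turns into b phi_i b^-1 e_j, and b^-1 e_j = e_j. *)
Lemma opcol_act b x c : b \in unitmx ->
  (forall i j, c = Some (i, j) -> b *m basis j = basis j) ->
  opcol (act b x) c = b *m opcol x c.
Proof.
move=> ub; case: c => [[i j]|//] /(_ i j erefl) bj /=.
rewrite ffunE !colE -!mulmxA; congr (_ *m (_ *m _)).
by rewrite -{1}bj mulKmx.
Qed.

Lemma mulmx_fix b (w : 'cV[k]_d) :
  (forall r, w r 0 != 0 -> b *m basis r = basis r) -> b *m w = w.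
Proof.
move=> bw; rewrite [w]matrix_sum_delta mulmx_sumr; apply: eq_bigr => r _.
rewrite big_ord1 -scalemxAr; have [->|/bw ->//] := eqVneq (w r 0) 0.
by rewrite !scale0r.
Qed.

Lemma normal_height p x (l : 'I_d) : lower x -> normal p x -> (l < size p)%N ->
  (height (nth None p l) <= l)%N.
Proof.
move=> lx /(_ l) px lp; rewrite leqNgt; apply/negP => /lx.
by have [-> _ /eqP] := px lp; rewrite oner_eq0.
Qed.

(* The l-th pivot column is v or phi_i e_j with j < l; so [b] fixes the e_l one
   after the other. *)
Lemma normal_fix p b x : ltri b -> lower x -> normal p x -> normal p (act b x) ->
  forall l : 'I_d, (l < size p)%N -> b *m basis l = basis l.
Proof.
move=> tb lx px py l; have [ub /is_trig_mxP bt _] := and3P tb.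
have [n] := ubnP l; elim: n l => // n IHn l /ltnSE ln lp.
set c := nth None p l; have hc := normal_height lx px lp.
have IH (r : 'I_d) : (r < l)%N -> b *m basis r = basis r.
  by move=> rl; apply: IHn; [exact: leq_trans rl ln|exact: ltn_trans rl lp].
have bc : opcol (act b x) c = b *m opcol x c.
  apply: opcol_act => // i j cE; apply: IH.
  by move: hc; rewrite -/c cE.
have [xl xr] := px _ lp; have [yl yr] := py _ lp.
rewrite -/c /entry in xl xr yl yr.
(* [w] is the part of the pivot column along the e_r with r < l, which [b] fixes by induction. *)
pose w := opcol x c - basis l.
have bw : b *m w = w.
  apply: mulmx_fix => r; rewrite !mxE eqxx andbT.
  case: (ltngtP l r) => [lr|rl _|lr].
  - by rewrite xr // -val_eqE /= gtn_eqF // subr0 eqxx.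
  - exact: IH.
  - by move/val_inj: lr => <-; rewrite xl eqxx subrr eqxx.
have bE : b *m basis l = opcol (act b x) c - w.
  by rewrite bc -bw -mulmxBr /w opprB addrCA subrr addr0.
(* Both pivot columns are 1 in row l and 0 beyond, so [bE] settles rows from l on; triangularity
   settles those before l. *)
apply/colP => r; case: (ltngtP l r) => [lr|rl|/val_inj <-].
- by rewrite bE !mxE yr // xr // !sub0r opprK.
- by rewrite -colE !mxE bt // -val_eqE /= ltn_eqF.
- by rewrite bE !mxE yl xl !eqxx subrr subr0.
Qed.

(** As [b] is lower triangular and fixes e_r for r < l, its row l is zero off the diagonal, so it
    only rescales the entries of candidate columns there. *)
Lemma entry_act p b x c (l : 'I_d) : ltri b -> lower x ->
  normal p x -> normal p (act b x) -> (l <= size p)%N -> (height c <= l)%N ->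
  entry (act b x) c l = b l l * entry x c l.
Proof.
move=> tb lx px py lp hc; have bf := normal_fix tb lx px py.
have [ub /is_trig_mxP bt _] := and3P tb.
rewrite /entry opcol_act // => [|i j cE]; last first.
  by apply: bf; move: hc; rewrite cE => /leq_trans; exact.
rewrite mxE (bigD1 l) //= big1 ?addr0 // => r rl.
case: (ltngtP l r) => [lr|rl'|/val_inj lr]; last by rewrite lr eqxx in rl.
  by rewrite bt ?mul0r.
have /colP/(_ l) := bf r (leq_trans rl' lp).
by rewrite -colE !mxE eqxx andbT -val_eqE /= gtn_eqF // => ->; rewrite mul0r.
Qed.

Lemma entry_act_eq0 p b x c (l : 'I_d) : ltri b -> lower x ->
  normal p x -> normal p (act b x) -> (l <= size p)%N -> (height c <= l)%N ->
  (entry (act b x) c l == 0) = (entry x c l == 0).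
Proof.
move=> tb lx px py lp hc; rewrite (entry_act tb lx px py lp hc) mulf_eq0.
by rewrite (negPf (ltri_diag l tb)).
Qed.

(** With d pivots [b] fixes every basis vector; so a full normal form is unique in its orbit. *)
Lemma normal_act_id p b x : ltri b -> lower x -> (d <= size p)%N ->
  normal p x -> normal p (act b x) -> act b x = x.
Proof.
move=> tb lx dp px py; suff -> : b = 1%:M by rewrite act1.
apply/matrixP => i j; have := normal_fix tb lx px py (leq_trans (ltn_ord j) dp).
by rewrite -colE => /colP/(_ i); rewrite !mxE eqxx andbT.
Qed.

Definition tailv (l : 'I_d) (w : 'cV[k]_d) : 'cV[k]_d :=
  \col_r (if (l <= r)%N then w r 0 else 0).

(* [pivmx l a] maps a to e_l and fixes the other basis vectors. *)
Definition pivmx l (a : 'cV[k]_d) : 'M[k]_d :=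
  1%:M + ((a l 0)^-1 *: (basis l - a)) *m delta_mx 0 l.

Definition pivmx_inv l (a : 'cV[k]_d) : 'M[k]_d :=
  1%:M + (a - basis l) *m delta_mx 0 l.

Lemma mul_col_delta (u w : 'cV[k]_d) l : u *m delta_mx 0 l *m w = w l 0 *: u.
Proof.
rewrite -mulmxA -rowE [row l w]mx11_scalar !mxE.
by rewrite mul_mx_scalar.
Qed.

Lemma pivmxK l (a : 'cV[k]_d) : a l 0 != 0 -> pivmx l a *m pivmx_inv l a = 1%:M.
Proof.
move=> al; rewrite /pivmx /pivmx_inv; set q := _ *: _; set t := a - _.
rewrite mulmxDl mul1mx mulmxDr mulmx1 [q *m _ *m _]mulmxA mul_col_delta.
rewrite -addrA -!mulmxDl -{1}[q]scale1r -scalerDl [t l 0]mxE.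
rewrite [in X in _ + (_ + X)]mxE.
rewrite mxE !eqxx addrCA subrr addr0 /q scalerA divff // scale1r.
by rewrite -opprB subrr mul0mx addr0.
Qed.

Lemma pivmxE l a (w : 'cV[k]_d) :
  pivmx l a *m w = w + (w l 0 / a l 0) *: (basis l - a).
Proof. by rewrite mulmxDl mul1mx mul_col_delta scalerA. Qed.

Lemma add_col_delta_trig (u : 'cV[k]_d) (l : 'I_d) :
  (forall r : 'I_d, (r < l)%N -> u r 0 = 0) ->
  is_trig_mx (1%:M + u *m delta_mx 0 l).
Proof.
move=> u0; apply/is_trig_mxP => i j ij.
rewrite !mxE big_ord1 !mxE -val_eqE /= ltn_eqF // add0r.
by have [jl|] := eqVneq j l; rewrite ?mulr0 // u0 ?mul0r // -jl.
Qed.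

Lemma pivmx_ltri l (a : 'cV[k]_d) : a l 0 != 0 ->
  (forall r : 'I_d, (r < l)%N -> a r 0 = 0) ->
  ltri (pivmx l a) /\ invmx (pivmx l a) = pivmx_inv l a.
Proof.
move=> al a0; have ab := pivmxK al; have [ua ub] := mulmx1_unit ab.
have iE : invmx (pivmx l a) = pivmx_inv l a.
  by rewrite -[LHS]mulmx1 -ab mulKmx.
split=> //; rewrite /ltri ua iE /=; apply/andP; split.
  apply: add_col_delta_trig => r rl.
  by rewrite !mxE (a0 r rl) -val_eqE /= ltn_eqF // subr0 mulr0.
apply: add_col_delta_trig => r rl.
by rewrite !mxE (a0 r rl) -val_eqE /= ltn_eqF // subr0.
Qed.

(** The base change fixes e_j for j < l, so it acts on columns of height at most l by plain
    multiplication. It turns the tail of column [c] into e_l and leaves the earlier pivots alone,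
    since their entry in row l is 0. *)
Lemma normal_rcons p x c (l : 'I_d) :
  lower x -> normal p x -> l = size p :> nat -> entry x c l != 0 ->
  normal (rcons p c) (act (pivmx l (tailv l (opcol x c))) x).
Proof.
move=> lx px lp xc0; set a := tailv l _; set b := pivmx l a.
have al : a l 0 = entry x c l by rewrite mxE leqnn.
have al0 : a l 0 != 0 by rewrite al.
have [r rl|tb _] := pivmx_ltri al0; first by rewrite mxE leqNgt rl.
have ub : b \in unitmx by case/and3P: tb.
have be e : (height e <= l)%N ->
    opcol (act b x) e = opcol x e + (entry x e l / entry x c l) *: (basis l - a).
  move=> he; rewrite opcol_act // ?pivmxE ?al // => i j cE.
  rewrite pivmxE mxE eqxx andbT -val_eqE /= gtn_eqF ?mul0r ?scale0r ?addr0 //.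
  by move: he; rewrite cE.
have hc : (height c <= l)%N.
  by rewrite leqNgt; apply/negP => /lx /eqP; rewrite (negPf xc0).
move=> r; rewrite size_rcons ltnS leq_eqVlt => /orP[/eqP|] rp.
  have {rp}-> : r = l by apply: val_inj; rewrite /= rp.
  have -> : nth None (rcons p c) l = c by rewrite nth_rcons lp ltnn eqxx.
  rewrite /entry be // divff // scale1r.
  split=> [|s ls]; rewrite !mxE; first by rewrite leqnn eqxx addrCA subrr addr0.
  by rewrite (ltnW ls) -val_eqE /= gtn_eqF // sub0r subrr.
rewrite nth_rcons rp; have [xr xs] := px _ rp.
have hr : (height (nth None p r) <= l)%N.
  by rewrite (leq_trans (normal_height lx px rp)) // lp ltnW.
rewrite /entry be // [entry x _ l]xs ?lp // mul0r scale0r addr0; split=> //.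
Qed.

(** All phi_i map into the hyperplane of vectors with l-th coordinate 0, so the algebra preserves
    it. As v must not lie in such a hyperplane, stability yields a nonzero entry in every row. *)
Lemma gen_alg_row_eq0 x (l : 'I_d) : (forall c, entry x c l = 0) ->
  forall a (w : 'cV[k]_d), gen_alg x.1 a -> w l 0 = 0 -> (a *m w) l 0 = 0.
Proof.
move=> x0 a + ga.
elim: ga => [c w|i w|{}a b _ IHa _ IHb w|{}a b _ IHa _ IHb w] w0.
- by rewrite mul_scalar_mx mxE w0 mulr0.
- rewrite mxE big1 // => j _; have := x0 (Some (i, j)).
  by rewrite /entry /= mxE => ->; rewrite mul0r.
- by rewrite mulmxDl mxE IHa // IHb // addr0.
- by rewrite -mulmxA IHa // IHb.
Qed.

Lemma stable_entry x (l : 'I_d) : stable x -> exists c, entry x c l != 0.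
Proof.
move=> sx; apply: contrapT => /forallNP x0.
have {}x0 c : entry x c l = 0 by apply: contrapT => /eqP; exact: x0.
have [a ga /matrixP/(_ l 0)] := sx (basis l).
rewrite (gen_alg_row_eq0 x0 ga (x0 None)) mxE !eqxx => /eqP.
by rewrite eq_sym oner_eq0.
Qed.

Lemma stable_act (g : 'M[k]_d) x : g \in unitmx -> stable x -> stable (act g x).
Proof.
move=> ug sx w; have [a ga aw] := sx (invmx g *m w).
exists (g *m a *m invmx g); last first.
  by rewrite /= -!mulmxA mulKmx // aw mulmxA mulmxV // mul1mx.
elim: ga {aw} => [c|i|{}a b _ IHa _ IHb|{}a b _ IHa _ IHb].
- rewrite mul_mx_scalar -scalemxAl mulmxV // scalemx1; exact: gen_alg_scalar.
- have := gen_alg_gen (act g x).1 i; by rewrite ffunE.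
- by rewrite mulmxDr mulmxDl; exact: gen_alg_add.
- have -> : g *m (a *m b) *m invmx g =
    (g *m a *m invmx g) *m (g *m b *m invmx g).
    by rewrite -!mulmxA mulKmx.
  exact: gen_alg_mul.
Qed.

(** By induction on l, e_l is reached from v: the l-th pivot column is v or phi_i e_j with j < l,
    and it differs from e_l by a combination of the e_r with r < l. *)
Lemma normal_stable p x : lower x -> normal p x -> (d <= size p)%N -> stable x.
Proof.
move=> lx px dp.
pose G (w : 'cV[k]_d) := exists2 a, gen_alg x.1 a & a *m x.2 = w.
have GD u w : G u -> G w -> G (u + w).
  move=> [a ga <-] [b gb <-]; exists (a + b); last by rewrite mulmxDl.
  exact: gen_alg_add.
have GM a u : gen_alg x.1 a -> G u -> G (a *m u).
  move=> ga [b gb <-]; exists (a *m b); last by rewrite mulmxA.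
  exact: gen_alg_mul.
have GZ (t : k) u : G u -> G (t *: u).
  by move=> Gu; rewrite -mul_scalar_mx; apply: GM => //; exact: gen_alg_scalar.
have Gv : G x.2.
  by exists 1%:M; [exact: gen_alg_scalar|rewrite mul1mx].
have G0 : G 0 by rewrite -(scale0r x.2); exact: GZ.
have Gsum (f : 'I_d -> k) (u : 'I_d -> 'cV[k]_d) :
    (forall r, f r != 0 -> G (u r)) -> G (\sum_r f r *: u r).
  move=> Gu; elim/big_ind: _ => // r _.
  by have [->|/Gu/GZ//] := eqVneq (f r) 0; rewrite scale0r.
have Ge (l : 'I_d) : G (basis l).
  have [n] := ubnP l; elim: n l => // n IHn l /ltnSE ln.
  have lp := leq_trans (ltn_ord l) dp.
  set c := nth None p l; have [xl xr] := px _ lp.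
  have hc := normal_height lx px lp.
  have Gc : G (opcol x c).
    move: hc; rewrite -/c; case: c {xl xr} => [[i j]|] //= jl.
    rewrite colE; apply: GM; first exact: gen_alg_gen.
    by apply: IHn; exact: leq_trans jl ln.
  have -> : basis l = opcol x c +
      \sum_(r < d) (if (r < l)%N then - entry x c r else 0) *: basis r.
    apply/colP => r; rewrite [RHS]mxE summxE (bigD1 r) //= big1 => [|s sr].
      rewrite !mxE !eqxx /= mulr1 addr0 andbT -val_eqE /=.
      case: (ltngtP r l) => [rl|lr|/val_inj ->].
      + by rewrite subrr.
      + by rewrite addr0 [opcol _ _ _ _]xr.
      + by rewrite addr0 [opcol _ _ _ _]xl.
    by rewrite !mxE eq_sym (negPf sr) mulr0.
  apply: GD => //; apply: Gsum => r; case: ifP => [rl _|_]; last by rewrite eqxx.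
  by apply: IHn; exact: leq_trans rl ln.
move=> w; have : G w; last by [].
rewrite [w]matrix_sum_delta; have -> : \sum_i \sum_(j < 1) w i j *: delta_mx i j
    = \sum_i w i 0 *: basis i by apply: eq_bigr => i _; rewrite big_ord1.
exact: Gsum.
Qed.

End NormalForms.


(** * Pivot candidates and free coordinates of a cell *)

Section Cells.
Variables (k : closedFieldType) (m d : nat).
Local Notation K := (option ('I_m * 'I_d)).
Implicit Types (x y : opvec k m d) (c e : K) (p : seq K) (fr : seq (K * 'I_d)).

Definition candidates p : seq K :=
  [seq c <- enum {: K} | (height c <= size p)%N & c \notin p].

Lemma mem_candidates p c :
  (c \in candidates p) = (height c <= size p)%N && (c \notin p).
Proof. by rewrite mem_filter mem_enum andbT. Qed.

Lemma uniq_candidates p : uniq (candidates p).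
Proof. exact/filter_uniq/enum_uniq. Qed.

Lemma card_height_le n : (n <= d)%N ->
  #|[pred c : K | (height c <= n)%N]| = (m * n).+1%N.
Proof.
move=> nd; pose f (a : option ('I_m * 'I_n)) : K :=
  omap (fun ij => (ij.1, widen_ord nd ij.2)) a.
have f_inj : injective f.
  by move=> [[i j]|] [[i' j']|] //= [-> /val_inj ->].
transitivity #|codom f|; last first.
  by rewrite card_codom // card_option card_prod !card_ord.
apply: eq_card => -[[i j]|]; rewrite !inE /=; last first.
  by apply/esym/codomP; exists None.
apply/idP/codomP => [jn|[[[i' j']|] // [_ ->]] //=].
by exists (Some (i, Ordinal jn)) => //; congr Some; congr pair; exact: val_inj.
Qed.

(** For l = [size p], the columns of height at most l are v and the phi_i e_j with j < l, in number
    m l + 1, and the l pivots in [p] are among them. *)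
Lemma size_candidates p : (0 < m)%N -> (size p <= d)%N -> uniq p ->
  (forall l, (l < size p)%N -> (height (nth None p l) <= l)%N) ->
  size (candidates p) = ((m - 1) * size p + 1)%N.
Proof.
move=> m0 pd up hp.
have -> : size (candidates p) =
    #|[predD [pred c : K | (height c <= size p)%N] & mem p]|.
  rewrite cardE /candidates; congr size; rewrite enumT /enum_mem.
  by apply: eq_filter => c; rewrite !inE andbC.
have := cardID (mem p) [pred c : K | (height c <= size p)%N].
rewrite card_height_le //.
have -> : #|[predI [pred c : K | (height c <= size p)%N] & mem p]| = size p.
  transitivity #|p|; last exact/card_uniqP.
  apply: eq_card => c; rewrite !inE andbC.
  case cp: (c \in p) => //=; rewrite -(nth_index None cp).
  by rewrite -index_mem in cp; rewrite (leq_trans (hp _ cp)) // ltnW.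
move=> E; apply: (@addnI (size p)); rewrite E.
by rewrite addnA -mulSn addn1 subn1 prednK.
Qed.

(* [fr] lists the positions (column, row) of the coordinates that are free in a
   cell. *)
Definition vanishing fr p y := forall c (l : 'I_d), (l < size p)%N ->
  c <> nth None p l -> (c, l) \notin fr -> entry y c l = 0.

(** In row l the first l + 1 pivots have prescribed entries 0 or 1, so [adm_free] bars these columns
    from being free there. *)
Record admissible p fr : Prop := Admissible {
  adm_uniq : uniq p;
  adm_height : forall l, (l < size p)%N -> (height (nth None p l) <= l)%N;
  adm_uniq_free : uniq fr;
  adm_free : forall c (l : 'I_d), (c, l) \in fr ->
    [/\ (l < size p)%N, (height c <= l)%N & c \notin take l.+1 p]
}.

Section Extension.
Variables (p : seq K) (fr : seq (K * 'I_d)) (s1 s2 : seq K) (c : K) (l : 'I_d).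
Hypothesis (lp : l = size p :> nat) (cE : candidates p = s1 ++ c :: s2).
Hypothesis (adm : admissible p fr).

(** When [c] is the first candidate nonzero in row l, the candidates in [s1] vanish there and those
    in [s2] become free. *)
Let fr' := fr ++ [seq (e, l) | e <- s2].

Let c_cand : (height c <= l)%N && (c \notin p).
Proof. by rewrite lp -mem_candidates cE mem_cat mem_head orbT. Qed.

Let mem_fr' e (r : 'I_d) :
  ((e, r) \in fr') = ((e, r) \in fr) || (r == l) && (e \in s2).
Proof.
rewrite mem_cat; congr orb; apply/mapP/andP => [[e' es [-> ->]]|[/eqP -> es]].
  by [].
by exists e.
Qed.

Lemma admissible_rcons : admissible (rcons p c) fr'.
Proof.
have [up hp uf fP] := adm; have /andP[hc cp] := c_cand.
have := uniq_candidates p; rewrite cE cat_uniq => /and3P[_ _] /= /andP[cs2 us2].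
split.
- by rewrite rcons_uniq cp.
- move=> r; rewrite size_rcons ltnS nth_rcons leq_eqVlt.
  by case: ltngtP => // [/hp //|->]; rewrite -lp.
- rewrite cat_uniq uf map_inj_uniq ?us2 ?andbT => [|e e' []//].
  apply/hasPn => _ /mapP[e _ ->]; apply/negP => /fP[].
  by rewrite lp ltnn.
- move=> e r; rewrite mem_fr' size_rcons => /orP[/fP[rp he er]|/andP[/eqP -> es]].
    split=> //; first exact: ltnW.
    by rewrite -cats1 takel_cat.
  rewrite -lp ltnS leqnn; have := mem_candidates p e.
  rewrite cE mem_cat inE es !orbT lp => /esym/andP[-> ep]; split=> //.
  rewrite take_oversize ?size_rcons // mem_rcons inE (negPf ep) orbF.
  by apply: contraNneq cs2 => <-.
Qed.

(** In row l the new condition concerns exactly [s1]: columns in [s2] are free, those of height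
    above l vanish by [lower], and earlier pivots vanish by normality. *)
Lemma vanishing_rcons y : lower y -> normal (rcons p c) y ->
  vanishing fr' (rcons p c) y <->
  vanishing fr p y /\ forall e, e \in s1 -> entry y e l = 0.
Proof.
move=> ly ny; have [up hp uf fP] := adm.
have := uniq_candidates p; rewrite cE cat_uniq => /and3P[_ /hasPn s12 _].
split=> [v|[v v1] e r].
  split=> [e r rp er efr|e es1].
    apply: v; first by rewrite size_rcons ltnS ltnW.
      by rewrite nth_rcons rp.
    by rewrite mem_fr' (negPf efr) -val_eqE /= lp ltn_eqF.
  apply: v; first by rewrite size_rcons lp.
    rewrite nth_rcons lp ltnn eqxx => ec.
    by have := s12 c (mem_head _ _); rewrite /= -ec es1.
  rewrite mem_fr' eqxx negb_or; apply/andP; split.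
    by apply/negP => /fP[]; rewrite lp ltnn.
  by apply/negP => /= es2; have := s12 e; rewrite inE es2 orbT /= es1 => /(_ isT).
rewrite size_rcons ltnS leq_eqVlt => /orP[/eqP rp|rp]; last first.
  rewrite nth_rcons rp => er; rewrite mem_fr' negb_or => /andP[efr _].
  exact: v.
have -> : r = l by apply: val_inj; rewrite /= rp lp.
rewrite nth_rcons lp ltnn eqxx => ec.
rewrite mem_fr' eqxx negb_or => /andP[_ /= es2].
have := mem_candidates p e; rewrite cE mem_cat inE (negPf es2) orbF.
have [|es1] := boolP (e \in s1); first by move=> /v1.
rewrite (introF eqP ec) => /esym/negbT; rewrite negb_and negbK -lp.
rewrite -ltnNge => /orP[/ly //|ep].
have ip : (index e p < size p)%N by rewrite index_mem.
have id : (index e p < d)%N by rewrite (leq_trans ip) // -lp ltnW.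
have [|_ /(_ l)] := ny (Ordinal id); first by rewrite size_rcons ltnS ltnW.
by rewrite nth_rcons /= ip nth_index // => ->; rewrite // lp.
Qed.

End Extension.

Definition cell_point p fr (s : seq k) : opvec k m d :=
  opvec_of (fun c l => if c == nth None p l then 1 else
    if (c, l) \in fr then s`_(index (c, l) fr) else 0).

Lemma entry_cell_point p fr s c l : entry (cell_point p fr s) c l =
  if c == nth None p l then 1 else
  if (c, l) \in fr then s`_(index (c, l) fr) else 0.
Proof. exact: entry_opvec_of. Qed.

Section FullCell.
Variables (p : seq K) (fr : seq (K * 'I_d)).
Hypothesis (pd : size p = d) (adm : admissible p fr).

Lemma cell_point_lower s : lower (cell_point p fr s).
Proof.
move=> c l lc; have [up hp uf fP] := adm; rewrite entry_cell_point.
have [cl|_] := eqVneq.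
  have := hp l; rewrite pd -cl (leqNgt (height c)) lc.
  by move=> /(_ (ltn_ord l)).
by case: ifP => // /fP[_]; rewrite (leqNgt (height c)) lc.
Qed.

Lemma cell_point_normal s : normal p (cell_point p fr s).
Proof.
move=> l lp; have [up hp uf fP] := adm; rewrite entry_cell_point eqxx.
split=> // r lr.
(* In a row r beyond l, the column p_l is not the pivot, as [p] has no repetitions, and not free, as
   it is among the first r + 1 pivots. *)
rewrite entry_cell_point nth_uniq // ?pd //.
rewrite ltn_eqF //; case: ifP => // /fP[_ _].
rewrite -{1}(nth_take (n0 := r.+1)) ?ltnS ?(ltnW lr) // mem_nth //.
by rewrite size_take pd; case: ifP => // _; rewrite ltnS ltnW.
Qed.

Lemma cell_point_vanishing s : vanishing fr p (cell_point p fr s).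
Proof.
by move=> c l _ /eqP/negPf cl /negPf cf; rewrite entry_cell_point cl cf.
Qed.

Lemma vanishing_cell_point y : normal p y -> vanishing fr p y ->
  y = cell_point p fr [seq entry y cl.1 cl.2 | cl <- fr].
Proof.
move=> ny vy; apply: opvec_eqP => c l; rewrite entry_cell_point.
have lp : (l < size p)%N by rewrite pd.
have [->|/eqP cl] := eqVneq; first by have [] := ny l lp.
case: ifP => [cf|/negbT cf]; last exact: vy.
by rewrite (nth_map (c, l)) ?index_mem // nth_index.
Qed.

Lemma entry_cell_point_free s i : size s = size fr -> (i < size fr)%N ->
  forall c0 : K * 'I_d, let cl := nth c0 fr i in
  entry (cell_point p fr s) cl.1 cl.2 = s`_i.
Proof.
move=> sf ifr c0 cl.
have [up hp uf fP] := adm; have clf : cl \in fr by exact: mem_nth.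
rewrite entry_cell_point -surjective_pairing clf index_uniq //.
have [|] := eqVneq => // cE; have [] := fP cl.1 cl.2.
  by rewrite -surjective_pairing.
move=> _ _; rewrite cE -{1}(nth_take (n0 := cl.2.+1)) // mem_nth //.
by rewrite size_take pd; case: ifP => // _; exact: ltn_ord.
Qed.

End FullCell.

End Cells.


(** * Bases adapted to a complete flag *)

Section Flag.
Variables (k : closedFieldType) (m d : nat) (F : nat -> {vspace 'cV[k]_d}).

(** The flag is built up from the last basis vector, so that strictly flag-lowering operators become
    strictly lower triangular. *)
Definition adapted (P : 'M[k]_d) := forall i (x : 'cV[k]_d), (i <= d)%N ->
  x \in F i <-> forall l : 'I_d, (l < d - i)%N -> (P *m x) l 0 = 0.

Hypothesis flagF : complete_flag F.

Lemma flag_mono i j : (i <= j)%N -> (j <= d)%N -> (F i <= F j)%VS.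
Proof.
elim: j => [|j IHj]; first by rewrite leqn0 => /eqP ->.
rewrite leq_eqVlt => /orP[/eqP ->//|ij] jd.
exact: subv_trans (IHj ij (ltnW jd)) (flagF.2 j jd).
Qed.

Lemma flag_step (j : 'I_d) : exists w : 'cV[k]_d,
  w \in F j.+1 /\ F j.+1 = (F j + <[w]>)%VS.
Proof.
have [dimF _] := flagF; have jd := ltn_ord j.
have /subvPn[w wF nwF] : ~~ (F j.+1 <= F j)%VS.
  by apply/negP => /dimvS; rewrite !dimF // ?ltnn // ltnW.
exists w; split=> //; apply/esym/eqP.
rewrite eqEdim subv_add flagF.2 // -memvE wF /=.
rewrite dimF // -{1}(dimF j (ltnW jd)) ltn_neqAle dimvS ?addvSl // andbT.
apply: contra nwF => dE; have := eqEdim (F j) (F j + <[w]>)%VS.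
by rewrite addvSl -(eqP dE) leqnn => /eqP ->; rewrite memvE addvSr.
Qed.

(** Vectors w_j spanning F_(j+1) modulo F_j, taken in reverse order, are the columns of [Q]. Every
    vector of F_j is [Q] applied to a vector supported on the last j coordinates; as F_d is
    everything, [Q] is invertible, and [P] is its inverse. *)
Lemma flag_basis : exists2 P : 'M[k]_d, P \in unitmx & adapted P.
Proof.
have [dimF incF] := flagF; have [w wP] := choice flag_step.
pose Q : 'M[k]_d := \matrix_(i, l) w (rev_ord l) i 0.
have QF j (x : 'cV[k]_d) : (j <= d)%N -> x \in F j ->
    exists y : 'cV[k]_d,
      Q *m y = x /\ forall l : 'I_d, (l < d - j)%N -> y l 0 = 0.
  elim: j x => [|j IHj] x jd.
    have /eqP -> : F 0 == 0%VS by rewrite -dimv_eq0 dimF.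
    rewrite memv0 => /eqP ->; exists 0; rewrite mulmx0.
    by split=> // l _; rewrite mxE.
  pose jo := Ordinal jd; have [_ /= ->] := wP jo.
  move=> /memv_addP[f /(IHj _ (ltnW jd))[y [yf y0]] [_ /vlineP[c ->] ->]].
  exists (y + c *: delta_mx (rev_ord jo) 0); split.
    rewrite mulmxDr yf -scalemxAr -colE; congr (_ + _ *: _).
    by apply/colP => i; rewrite !mxE rev_ordK.
  move=> l lj; rewrite !mxE y0; last by rewrite (leq_trans lj) // leq_sub2l.
  by rewrite -val_eqE /= ltn_eqF // mulr0 addr0.
have Fd : F d = fullv.
  by apply/eqP; rewrite eqEdim subvf dimF // dimvf /dim /= ?muln1 leqnn.
have /choice[Y YP] : forall j : 'I_d, exists y : 'cV[k]_d, Q *m y = delta_mx j 0.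
  move=> j; have [|y [yj _]] := QF d (delta_mx j 0) (leqnn d).
    by rewrite Fd memvf.
  by exists y.
have QY : Q *m (\matrix_(i, j) Y j i 0) = 1%:M.
  apply/matrixP => i j; have /matrixP/(_ i 0) := YP j.
  by rewrite !mxE eqxx andbT => <-; apply: eq_bigr => r _; rewrite !mxE.
have [uQ _] := mulmx1_unit QY.
exists (invmx Q); first by rewrite unitmx_inv.
move=> i x id; split=> [/(QF _ _ id)[y [<- y0]]|x0]; first by rewrite mulKmx.
rewrite -(mulKVmx uQ x); set y := invmx Q *m x in x0 *.
have -> : Q *m y = \sum_l y l 0 *: w (rev_ord l).
  apply/colP => r; rewrite mxE summxE; apply: eq_bigr => l _.
  by rewrite !mxE mulrC.
(* For l >= d - i, the column w_(d-1-l) lies in F_(d-l), hence in F_i. *)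
apply: rpred_sum => l _; have [li|il] := ltnP l (d - i).
  by rewrite x0 // scale0r mem0v.
apply: rpredZ; have [wF _] := wP (rev_ord l); apply: subvP wF.
by apply: flag_mono => //=; rewrite subnSK // leq_subCl.
Qed.

(** The j-th adapted basis vector lies in F_(d-j), and its image in F_(d-j-1) means that the first j
    + 1 coordinates vanish, which is the bound [height]. *)
Lemma lower_act_flag (P : 'M[k]_d) : P \in unitmx ->
  adapted P ->
  forall x : opvec k m d, lower (act P x) <-> forall i, flag_nilp F (x.1 i).
Proof.
move=> uP FP x; split=> [lx i j w jd|fx [[i j]|//] l] .
  move=> /FP - /(_ jd) w0; apply/FP; first exact: ltnW.
  move=> l lj; have -> : P *m (x.1 i *m w) = P *m x.1 i *m invmx P *m (P *m w).
    by rewrite !mulmxA mulmxKV.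
  rewrite mxE big1 // => r _; have [rl|lr] := ltnP r l.
    by rewrite w0 ?mulr0 // -subSS (leq_trans rl) // subSS -ltnS -subSn // ltnW.
  have := lx (Some (i, r)) l; rewrite /entry /= ffunE mxE => -> //.
  by rewrite mul0r.
rewrite ltnS => lj; rewrite /entry /= ffunE colE -!mulmxA.
have jd := ltn_ord j; have dj : (d - j.+1 < d)%N by rewrite subnSK // leq_subr.
have := fx i (d - j.+1)%N (invmx P *m delta_mx j 0) dj.
move=> xF; have/FP : x.1 i *m (invmx P *m delta_mx j 0) \in F (d - j.+1)%N.
  apply: xF; apply/FP => // r; rewrite subnSK // subKn ?(ltnW jd) // => rj.
  by rewrite mulKVmx // mxE -val_eqE /= ltn_eqF.
by apply; [exact: ltnW|rewrite subKn].
Qed.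

(** Preserving every F_i amounts to being lower triangular in the adapted basis. The equality in
    [borel] gives this for both [g] and its inverse. *)
Lemma ltri_borel (P g : 'M[k]_d) : P \in unitmx ->
  adapted P ->
  borel F g <-> ltri (P *m g *m invmx P).
Proof.
move=> uP FP.
have trigP (A : 'M[k]_d) : is_trig_mx (P *m A *m invmx P) <->
    forall i (x : 'cV[k]_d), (i <= d)%N -> x \in F i -> A *m x \in F i.
  split=> [/is_trig_mxP tA i x id xF|AF].
    apply/FP => // l li; have -> : P *m (A *m x) = P *m A *m invmx P *m (P *m x).
      by rewrite !mulmxA mulmxKV.
    rewrite mxE big1 // => r _; have [lr|rl] := ltnP l r.
      by rewrite tA ?mul0r.
    by move/FP: xF => -> //; rewrite ?mulr0 // (leq_ltn_trans rl).
  apply/is_trig_mxP => l j lj; have jd := ltnW (ltn_ord j).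
  have [+ _] := FP (d - j)%N (A *m (invmx P *m delta_mx j 0)) (leq_subr _ _).
  have -> : P *m (A *m (invmx P *m delta_mx j 0)) = col j (P *m A *m invmx P).
    by rewrite colE !mulmxA.
  rewrite subKn // => /(_ _ l lj); rewrite [col _ _ _ _]mxE; apply.
  apply: AF; first exact: leq_subr.
  apply/FP; first exact: leq_subr.
  by move=> r; rewrite subKn // => rj; rewrite mulKVmx // mxE -val_eqE /= ltn_eqF.
have iE : g \in unitmx -> invmx (P *m g *m invmx P) = P *m invmx g *m invmx P.
  by move=> ug; rewrite !invmxM ?unitmx_mul ?unitmx_inv ?uP // invmxK mulmxA.
rewrite /ltri !unitmx_mul unitmx_inv uP andbT /=.
split=> [[ug gF]|/and3P[ug tg tg']].
  rewrite ug iE //=; apply/andP; split; apply/trigP => i x id.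
    by rewrite gF.
  by rewrite -[_ *m x \in _]gF // mulKVmx.
split=> // i x id; apply/idP/idP; last by move/trigP: tg; exact.
by rewrite iE // in tg'; move/trigP: tg' => tg' /(tg' _ _ id); rewrite mulKmx.
Qed.

End Flag.


(** * Charts of the quotient *)

Section RegularOperators.
Local Open Scope classical_set_scope.
Variables (k : closedFieldType) (m d : nat) (X : space k).
Local Notation K := (option ('I_m * 'I_d)).
Implicit Types (U : set X) (f : X -> opvec k m d).

Definition reg_mx U p q (M : X -> 'M[k]_(p, q)) :=
  forall i j, reg U (fun x => M x i j).

Definition reg_opvec U f := forall c l, reg U (fun x => entry (f x) c l).

Lemma reg_mxM U p q r (M : X -> 'M[k]_(p, q)) (N : X -> 'M[k]_(q, r)) :
  opn U -> reg_mx U M -> reg_mx U N -> reg_mx U (fun x => M x *m N x).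
Proof.
move=> oU rM rN i j.
have rs : reg U (fun x => \sum_l M x i l * N x l j).
  by apply: reg_sum => // l _; exact: regM.
by apply: reg_eq rs _ => x _; rewrite mxE.
Qed.

Lemma reg_mxD U p q (M N : X -> 'M[k]_(p, q)) :
  reg_mx U M -> reg_mx U N -> reg_mx U (fun x => M x + N x).
Proof.
by move=> rM rN i j; apply: reg_eq (regD (rM i j) (rN i j)) _ => x _; rewrite mxE.
Qed.

Lemma reg_mx_cst U p q (M : 'M[k]_(p, q)) : opn U -> reg_mx U (fun=> M).
Proof. by move=> oU i j; exact: reg_cst. Qed.

Lemma reg_mxZ U p q (a : X -> k) (M : X -> 'M[k]_(p, q)) :
  reg U a -> reg_mx U M -> reg_mx U (fun x => a x *: M x).
Proof.
by move=> ra rM i j; apply: reg_eq (regM ra (rM i j)) _ => x _; rewrite mxE.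
Qed.

Lemma reg_mxB U p q (M N : X -> 'M[k]_(p, q)) :
  reg_mx U M -> reg_mx U N -> reg_mx U (fun x => M x - N x).
Proof.
move=> rM rN i j.
have rm := regM (reg_cst (-1) (reg_opn (rN i j))) (rN i j).
by apply: reg_eq (regD (rM i j) rm) _ => x _; rewrite !mxE mulN1r.
Qed.

(** The inverse is supplied as a matrix function [h] of its own, so that regularity of matrix
    inversion does not enter. *)
Lemma reg_act U (g h : X -> 'M[k]_d) f : opn U ->
  (forall x, U x -> invmx (g x) = h x) ->
  reg_mx U g -> reg_mx U h -> reg_opvec U f ->
  reg_opvec U (fun x => act (g x) (f x)).
Proof.
move=> oU gh rg rh rf [[i j]|] l; last first.
  have r2 : reg_mx U (fun x => (f x).2).
    by move=> a b; rewrite (ord1 b); exact: rf None a.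
  exact: (reg_mxM oU rg r2).
have r1 : reg_mx U (fun x => (f x).1 i).
  move=> a b; apply: reg_eq (rf (Some (i, b)) a) _ => x _.
  by rewrite /entry /= mxE.
apply: reg_eq (reg_mxM oU (reg_mxM oU rg r1) rh l j) _ => x Ux.
by rewrite [RHS]mxE ffunE gh.
Qed.

Lemma morphism_opvec (f : X -> affine (opvec k m d)) :
  reg_opvec setT f -> morphism f.
Proof.
move=> rf; apply: morphism_affine => i.
have rs : reg setT (fun x => \sum_c \sum_l entry (f x : opvec k m d) c l *
    coord (vbasis {:opvec k m d}) i
      (opvec_of (fun e r => ((e == c) && (r == l))%:R))).
  apply: reg_sum => [|c _]; first exact: opnT.
  apply: reg_sum => [|l _]; first exact: opnT.
  by apply: regM; [exact: rf|exact: reg_cst (opnT _)].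
apply: reg_eq rs _ => x _.
rewrite [in RHS](opvec_sum_entry (f x : opvec k m d)) linear_sum.
apply: eq_bigr => c _; rewrite linear_sum; apply: eq_bigr => l _.
by rewrite linearZ.
Qed.

End RegularOperators.

Section StableNilp.
Local Open Scope classical_set_scope.
Variables (k : closedFieldType) (m d : nat) (F : nat -> {vspace 'cV[k]_d}).
Variable P : 'M[k]_d.
Hypothesis uP : P \in unitmx.
Hypothesis FP : adapted F P.
Local Notation S := (@stable_nilp k m d F).
Local Notation K := (option ('I_m * 'I_d)).

Definition coords (x : S) : opvec k m d := act P (sval x).

Lemma coords_lower x : lower (coords x).
Proof. by apply/(lower_act_flag uP FP); case: (svalP x). Qed.

Lemma coords_stable x : stable (coords x).
Proof. by apply: stable_act => //; case: (svalP x). Qed.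

Lemma reg_coords : reg_opvec setT coords.
Proof.
apply: (@reg_act _ _ _ _ _ (fun=> P) (fun=> invmx P)) => //.
- exact: opnT.
- exact: reg_mx_cst (opnT _).
- exact: reg_mx_cst (opnT _).
move=> c l.
exact: (reg_morphism (@sval_morphism _ _ _) (reg_linear (@coordinate k m d c l))).
Qed.

(** Undoing the constant base change [P] preserves regularity. This is how affine cells are mapped
    into the stable locus. *)
Lemma coords_lift (T : space k) (f : T -> opvec k m d) :
  reg_opvec setT f -> (forall t, lower (f t)) -> (forall t, stable (f t)) ->
  exists2 h : T -> S, morphism h & forall t, coords (h t) = f t.
Proof.
move=> rf lf sf.
have hP t : (forall i, flag_nilp F ((act (invmx P) (f t)).1 i)) /\
    stable (act (invmx P) (f t)).
  split; last by apply: stable_act; rewrite ?unitmx_inv.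
  by apply/(lower_act_flag uP FP); rewrite actVK.
exists (fun t => exist _ (act (invmx P) (f t)) (hP t)); last first.
  by move=> t; rewrite /coords /= actVK.
apply: morphism_induced; apply: morphism_opvec.
apply: (@reg_act _ _ _ _ _ (fun=> invmx P) (fun=> P)) => //.
- exact: opnT.
- by move=> _ _; rewrite invmxK.
- exact: reg_mx_cst (opnT _).
- exact: reg_mx_cst (opnT _).
Qed.

Lemma borel_orbit_coords (x y : S) : borel_orbit x y <->
  exists2 b, ltri b & coords y = act b (coords x).
Proof.
split=> [[g gB gxy]|[b tb yx]].
  have ug := gB.1; exists (P *m g *m invmx P); first exact/(ltri_borel _ uP FP).
  by rewrite /coords -gxy -!actM ?unitmx_mul ?unitmx_inv ?uP ?ug // mulmxKV.
have /and3P[ub _ _] := tb.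
exists (invmx P *m b *m P).
  by apply/(ltri_borel _ uP FP); rewrite !mulmxA mulmxV // mul1mx mulmxK.
rewrite !actM ?unitmx_mul ?unitmx_inv ?uP ?ub //.
by rewrite -[act P _]/(coords x) -yx /coords actK.
Qed.

Variables (Z : variety k) (p : S -> Z).
Hypothesis quot : geometric_quotient (@borel_orbit k m d F) p.

Lemma quotient_morphism : morphism p.
Proof.
by split=> [U /(gq_opn quot)|U f /(gq_reg quot)].
Qed.

Definition normal_rep (q : seq K) (z : Z) (y : opvec k m d) :=
  normal q y /\ exists x b, [/\ p x = z, ltri b & y = act b (coords x)].

Definition chart (q : seq K) : set Z := [set z | exists y, normal_rep q z y].

Lemma normal_rep_lower q z y : normal_rep q z y -> lower y.
Proof.
move=> [_ [x [b [_ tb ->]]]].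
by apply: lower_act => //; exact: coords_lower.
Qed.

Lemma normal_rep_stable q z y : normal_rep q z y -> stable y.
Proof.
move=> [_ [x [b [_ /and3P[ub _ _] ->]]]].
by apply: stable_act => //; exact: coords_stable.
Qed.

Lemma normal_rep_orbit q q' z y y' : normal_rep q z y -> normal_rep q' z y' ->
  exists2 b, ltri b & y' = act b y.
Proof.
move=> [_ [x [b [xz tb ->]]]] [_ [x' [b' [x'z tb' ->]]]].
have /(gq_fibre quot)/borel_orbit_coords[g tg ->] : p x = p x' by rewrite xz x'z.
have /and3P[ub _ _] := tb; have /and3P[ub' _ _] := tb'; have /and3P[ug _ _] := tg.
exists (b' *m g *m invmx b).
  by apply: ltriM; [exact: ltriM|exact: ltriV].
by rewrite !actM ?unitmx_mul ?unitmx_inv ?ub ?ub' ?ug // actK.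
Qed.

Lemma normal_rep_act q z y b : normal_rep q z y -> ltri b ->
  forall q', normal q' (act b y) -> normal_rep q' z (act b y).
Proof.
move=> [_ [x [b' [xz tb' ->]]]] tb q' nq; split=> //.
exists x, (b *m b'); split=> //; first exact: ltriM.
by have /and3P[ub _ _] := tb; have /and3P[ub' _ _] := tb'; rewrite actM.
Qed.

Lemma normal_rep_unique q z y y' : (d <= size q)%N ->
  normal_rep q z y -> normal_rep q z y' -> y' = y.
Proof.
move=> dq ry ry'; have [b tb yy'] := normal_rep_orbit ry ry'.
rewrite yy'; apply: (normal_act_id tb (normal_rep_lower ry) dq); first by case: ry.
by rewrite -yy'; case: ry'.
Qed.

(** This makes the vanishing of a candidate in row l a condition on [z] alone. *)
Lemma normal_rep_entry_eq0 q z y y' c (l : 'I_d) :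
  normal_rep q z y -> normal_rep q z y' -> (l <= size q)%N -> (height c <= l)%N ->
  (entry y' c l == 0) = (entry y c l == 0).
Proof.
move=> ry ry' lq hc; have [b tb yy'] := normal_rep_orbit ry ry'.
have [ny _] := ry; have [ny' _] := ry'; rewrite yy' in ny' *.
exact: entry_act_eq0 tb (normal_rep_lower ry) ny ny' lq hc.
Qed.

Lemma normal_belast q c (y : opvec k m d) : normal (rcons q c) y -> normal q y.
Proof.
move=> ny l lq; have := ny l; rewrite size_rcons nth_rcons lq; apply.
by rewrite ltnS ltnW.
Qed.

Lemma normal_rep_belast q c z y : normal_rep (rcons q c) z y -> normal_rep q z y.
Proof. by move=> [/normal_belast ny yx]. Qed.

(** A nonzero entry allows the pivot step [normal_rcons]. Conversely the new pivot entry is 1, and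
    its nonvanishing passes to every representative that is normal for [q]. *)
Lemma chart_rcons q c z y (l : 'I_d) : l = size q :> nat -> normal_rep q z y ->
  chart (rcons q c) z <-> entry y c l != 0.
Proof.
move=> lq ry; split=> [[y' ry']|yc]; last first.
  have ly := normal_rep_lower ry.
  have ny := normal_rcons ly ry.1 lq yc.
  have [|r rl|tb _] := @pivmx_ltri _ _ l (tailv l (opcol y c)).
  - by rewrite mxE leqnn.
  - by rewrite mxE leqNgt rl.
  by eexists; exact: normal_rep_act ry tb _ ny.
have yl : entry y' c l = 1.
  have [/(_ l) + _] := ry'; rewrite size_rcons nth_rcons lq ltnn eqxx.
  by move=> /(_ (leqnn _))[].
have hc : (height c <= l)%N.
  rewrite leqNgt; apply/negP => /(normal_rep_lower ry').
  by rewrite yl => /eqP; rewrite oner_eq0.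
rewrite -(normal_rep_entry_eq0 ry (normal_rep_belast ry') _ hc) ?lq //.
by rewrite yl oner_neq0.
Qed.

Lemma chart_belast q c z : chart (rcons q c) z -> chart q z.
Proof. by move=> [y /normal_rep_belast ry]; exists y. Qed.

Lemma chart_nil : chart [::] = setT.
Proof.
apply/seteqP; split=> // z _; have [x xz] := gq_surj quot z.
exists (coords x); split=> //; exists x, 1%:M.
by rewrite act1; split=> //; exact: ltri1.
Qed.

(** The normal form is computed by successive pivot steps, and each of them divides only by the
    chosen candidate entry, which is nonzero on the preimage of the chart. *)
Lemma chart_section q : (size q <= d)%N -> exists2 s : S -> opvec k m d,
  reg_opvec (p @^-1` chart q) s &
  forall x, chart q (p x) -> normal_rep q (p x) (s x).
Proof.
elim/last_ind: q => [_|q c IHq].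
  exists coords => [|x _]; first by rewrite chart_nil; exact: reg_coords.
  by split=> //; exists x, 1%:M; rewrite act1; split=> //; exact: ltri1.
rewrite size_rcons => qd; have [s rs sP] := IHq (ltnW qd).
pose l := Ordinal qd; have lq : l = size q :> nat by [].
pose a x := tailv l (opcol (s x) c).
pose U := p @^-1` chart q `&` [set x | entry (s x) c l != 0].
have UE : p @^-1` chart (rcons q c) = U.
  apply/seteqP; split=> [x xc|x [xq xc]].
    have xq := chart_belast xc.
    by split=> //=; apply/(chart_rcons c lq (sP x xq)).
  exact/(chart_rcons c lq (sP x xq)).
have oU : opn U by exact: opn_neq0 (rs c l).
have rsU : reg_opvec U s by move=> e r; apply: reg_sub (rs e r) oU _ => x [].
have ra : reg_mx U a.
  move=> i j; rewrite (ord1 j); case: (leqP l i) => li.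
    by apply: reg_eq (rsU c i) _ => x _; rewrite mxE li.
  by apply: reg_eq (reg_cst 0 oU) _ => x _; rewrite mxE leqNgt li.
have rd : reg U (fun x => (a x l 0)^-1).
  apply: reg_eq (reg_sub (regV (rs c l)) oU _) _ => // x _.
  by rewrite mxE leqnn.
have rl : reg_mx U (fun=> delta_mx l 0 : 'cV[k]_d) by exact: reg_mx_cst.
have rr : reg_mx U (fun=> delta_mx 0 l : 'rV[k]_d) by exact: reg_mx_cst.
have r1 : reg_mx U (fun=> 1%:M : 'M[k]_d) by exact: reg_mx_cst.
have tri x : U x ->
    ltri (pivmx l (a x)) /\ invmx (pivmx l (a x)) = pivmx_inv l (a x).
  move=> [_ /= xc]; apply: pivmx_ltri => [|r rl']; first by rewrite mxE leqnn.
  by rewrite mxE leqNgt rl'.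
exists (fun x => act (pivmx l (a x)) (s x)).
  rewrite UE; apply: (@reg_act _ _ _ _ _ _ (fun x => pivmx_inv l (a x))) => //.
  - by move=> x /tri[].
  - apply: reg_mxD => //; apply: reg_mxM => //.
    by apply: reg_mxZ => //; exact: reg_mxB.
  - apply: reg_mxD => //; apply: reg_mxM => //; exact: reg_mxB.
move=> x xc; have := xc; rewrite -[chart _ _]/((p @^-1` chart _) x) UE => Ux.
have [xq xe] := Ux; have [tb _] := tri x Ux; have ry := sP x xq.
apply: (normal_rep_act ry tb).
exact: (normal_rcons (normal_rep_lower ry) ry.1).
Qed.

Lemma chart_opn q : (size q <= d)%N -> opn (chart q).
Proof.
(* For d = 0 there are no coordinates, and [reg_opvec U] says nothing on U. *)
move=> qd; have [d0|d0] := posnP d.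
  have /nilP -> : nilp q by rewrite /nilp -leqn0 -d0.
  rewrite chart_nil; exact: opnT.
have [s rs _] := chart_section qd; apply/(gq_opn quot).
exact: reg_opn (rs None (Ordinal d0)).
Qed.

End StableNilp.


(** * The class of the quotient as a sum over cells *)

Section ClassOfQuotient.
Local Open Scope classical_set_scope.
Variables (k : closedFieldType) (m d : nat) (F : nat -> {vspace 'cV[k]_d}).
Variable P : 'M[k]_d.
Hypothesis uP : P \in unitmx.
Hypothesis FP : adapted F P.
Local Notation S := (@stable_nilp k m d F).
Local Notation K := (option ('I_m * 'I_d)).
Variables (Z : variety k) (p : S -> Z).
Hypothesis quot : geometric_quotient (@borel_orbit k m d F) p.
Local Notation rep := (normal_rep P p).
Local Notation chart := (chart P p).

(** Quantifying over all representatives makes the condition independent of their choice; outside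
    the chart [T] is unrestricted. *)
Definition cut_out (q : seq K) (fr : seq (K * 'I_d)) (T : set Z) :=
  forall z y, rep q z y -> T z <-> vanishing fr q y.

(** One map fills the free coordinates into a normal form and projects it to [Z]; the other reads
    them off from the unique normal form. *)
Lemma full_cell_isomorphic q fr (T : set Z) : size q = d -> admissible q fr ->
  cut_out q fr T -> isomorphic (An k (size fr)) (subspace (T `&` chart q)).
Proof.
move=> qd adm Tq.
have cl := cell_point_lower qd adm; have cn := cell_point_normal qd adm.
have sz (s : An k (size fr)) : size (sval s) = size fr by exact: size_An.
have [|t|t|h mh hE] := @coords_lift _ m _ F _ uP FP (An k (size fr))
    (fun s => cell_point q fr (sval s)).
- move=> c l; case cE : (c == nth None q l).
    by apply: reg_eq (reg_cst 1 (opnT _)) _ => s _; rewrite entry_cell_point cE.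
  case cf : ((c, l) \in fr); last first.
    by apply: reg_eq (reg_cst 0 (opnT _)) _ => s _; rewrite entry_cell_point cE cf.
  have := @reg_An k (size fr) (index (c, l) fr).
  rewrite index_mem => /(_ cf) ri.
  by apply: reg_eq ri _ => s _; rewrite entry_cell_point cE cf.
- exact: cl.
- by apply: normal_stable (cl k _) (cn k _) _; rewrite qd.
have hrep s : rep q (p (h s)) (cell_point q fr (sval s)).
  split; first exact: cn.
  exists (h s), 1%:M; split=> //; first exact: ltri1.
  by rewrite act1 hE.
have fP s : (T `&` chart q) (p (h s)).
  split; last by exists (cell_point q fr (sval s)).
  by apply/(Tq _ _ (hrep s)); exact: cell_point_vanishing.
have /choice[Y YP] : forall z, exists y, chart q z -> rep q z y.
  move=> z; have [[y ry]|nz] := pselect (chart q z); first by exists y.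
  by exists 0.
pose coordinates (y : opvec k m d) := [seq entry y cl.1 cl.2 | cl <- fr].
have gP z : An_pts (size fr) (coordinates (Y z)) by exact: size_map.
exists (fun s => exist _ (p (h s)) (fP s)).
exists (fun z => exist _ (coordinates (Y (sval z))) (gP (sval z))); split.
- apply: morphism_induced; exact: morphism_comp mh (quotient_morphism quot).
- apply: morphism_An => i ifr /=.
  (* [K * 'I_d] is empty for d = 0, so the default for [nth] is taken from [fr], which is nonempty
     here. *)
  have [c0 _] : exists c0 : K * 'I_d, True.
    by case: (fr) ifr => [//|c0 ? _]; exists c0.
  pose e := nth c0 fr i.
  have [s rs sP] : exists2 s : S -> opvec k m d, reg_opvec (p @^-1` chart q) s &
      forall x, chart q (p x) -> rep q (p x) (s x).
    by apply: (chart_section uP FP quot); rewrite qd.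
  (* Regularity on the quotient is tested on the preimage, where uniqueness identifies [Y] composed
     with [p] with the regular section [s]. *)
  have rY : reg (chart q) (fun z => entry (Y z) e.1 e.2).
    apply/(gq_reg quot); apply: reg_eq (rs e.1 e.2) _ => x xq /=.
    congr entry; apply: (normal_rep_unique uP FP quot _ (YP _ xq) (sP _ xq)).
    by rewrite qd.
  split=> [|z _]; first exact: ind_opnT.
  exists (chart q), (fun z => entry (Y z) e.1 e.2); split=> //.
    by have [] := svalP z.
  by move=> z' _ _; rewrite (nth_map c0).
- move=> s; apply: An_inj => /=.
  have := normal_rep_unique uP FP quot _ (hrep s) (YP _ (fP s).2).
  rewrite qd leqnn => /(_ isT) ->.
  apply: (@eq_from_nth _ 0) => [|i]; first by rewrite size_map sz.
  rewrite size_map => ifr; have [c0 _] : exists c0 : K * 'I_d, True.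
    by case: (fr) ifr => [//|c0 ? _]; exists c0.
  by rewrite (nth_map c0) // (entry_cell_point_free qd adm).
- move=> z; have [Tz zq] := svalP z; have rz := YP _ zq.
  have yE : cell_point q fr (coordinates (Y (sval z))) = Y (sval z).
    exact/esym/(vanishing_cell_point qd rz.1)/(Tq _ _ rz).
  have [_ [x [b [xz tb yx]]]] := rz.
  have : p (h (exist _ (coordinates (Y (sval z))) (gP (sval z)))) = sval z.
    rewrite -[RHS]xz; apply/(gq_fibre quot)/(borel_orbit_coords uP FP).
    exists (invmx b); first exact: ltriV.
    rewrite hE /= yE yx actK //.
    by case/and3P: tb.
  by case: z {Tz zq rz yE xz yx} => z Tz; exact: eq_exist.
Qed.

Local Notation L := (k0_lefschetz k).
Let stage l : K0Var k := \sum_(j < (m - 1) * l + 1) L ^+ j.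

(* Given the pivots q, the charts of [rcons q c] for the candidates c cover the
   chart of q. Remove them one after the other in the order of [candidates q]:
   the points removed with c have the value 0 at the earlier candidates and a
   nonzero value, scaled to 1, at c, and their values at the later candidates are
   new free coordinates. *)
Lemma clsd_class_cut_out : (0 < m)%N ->
  forall t q fr (T : set Z), (size q + t)%N = d -> admissible q fr -> clsd T ->
  cut_out q fr T ->
  clsd_class T =
    clsd_class (T `\` chart q) + L ^+ size fr * \prod_(size q <= l < d) stage l.
Proof.
move=> m0; elim=> [|t IHt] q fr T qt adm cT Tq.
  (* All pivots are chosen, so [T] meets the chart in one affine cell. *)
  rewrite addn0 in qt; rewrite big_geq ?qt // mulr1 -k0_class_An.
  apply: clsd_classD => //; last exact: full_cell_isomorphic.
  by apply: (chart_opn uP FP quot); rewrite qt.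
have qd : (size q < d)%N.
  by apply: leq_trans (eq_leq qt); rewrite -addSnnS leq_addr.
pose l := Ordinal qd; have lq : l = size q :> nat by [].
rewrite big_ltn // mulrA.
have sc : size (candidates q) = ((m - 1) * size q + 1)%N.
  by apply: size_candidates => //; [exact: ltnW|case: adm|case: adm].
rewrite /stage -sc; set Q := \prod_(_ <= _ < _) _.
(* [T'] is the part of [T] still to be cut: the candidates in [s1] vanish on its points in the
   chart, and each candidate in [s2] will contribute one power of L. *)
suff cand_ind s2 : forall s1 (T' : set Z), candidates q = s1 ++ s2 -> clsd T' ->
    (forall z y, rep q z y -> T' z <->
      vanishing fr q y /\ forall e, e \in s1 -> entry y e l = 0) ->
    clsd_class T' = clsd_class (T' `\` chart q) +
      L ^+ size fr * (\sum_(j < size s2) L ^+ j) * Q.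
  apply: (cand_ind _ [::]) => // z y /Tq ->.
  by split=> [|[]].
elim: s2 => [|c s2 IHs2] s1 T' cE cT' T'q.
  (* If all candidates vanish in row l, then so does every column, which stability forbids. Hence
     [T'] misses the chart. *)
  rewrite big_ord0 mulr0 mul0r addr0; congr clsd_class.
  apply/seteqP; split=> [z Tz|z []//]; split=> // -[y ry].
  have [c yc] := stable_entry l (normal_rep_stable uP ry).
  have ly := normal_rep_lower uP FP ry.
  have [_ y0] := (T'q z y ry).1 Tz; move/eqP: yc; apply.
  have := mem_candidates q c; rewrite cE cats0.
  have [/y0 //|_ /esym/negbT] := boolP (c \in s1).
  rewrite negb_and negbK -ltnNge -lq => /orP[/ly //|cq].
  have iq : (index c q < size q)%N by rewrite index_mem.
  have [_ /(_ l)] := ry.1 (Ordinal (ltn_trans iq qd)) iq.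
  by rewrite /= nth_index //; apply.
have admc := admissible_rcons lq cE adm.
have oc : opn (chart (rcons q c)).
  by apply: (chart_opn uP FP quot); rewrite size_rcons.
(* On the chart with [c] as next pivot, the candidates [s2] add [size s2] free coordinates. *)
rewrite (IHt (rcons q c) (fr ++ [seq (e, l) | e <- s2])) //; first last.
- move=> z y ry; rewrite (T'q _ _ (normal_rep_belast ry)).
  by rewrite (vanishing_rcons lq cE adm (normal_rep_lower uP FP ry) ry.1).
- by rewrite size_rcons addSnnS.
(* Off that chart [c] vanishes in row l too, so it joins [s1]. *)
rewrite (IHs2 (rcons s1 c)) //; first last.
- move=> z y ry; split.
    move=> [/(T'q _ _ ry)[vy y1] /(chart_rcons uP FP quot c lq ry)/negP].
    rewrite negbK => /eqP yc; split=> // e.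
    by rewrite mem_rcons inE => /orP[/eqP ->|/y1].
  move=> [vy y1]; split.
    apply/(T'q _ _ ry); split=> // e es.
    by apply: y1; rewrite mem_rcons inE es orbT.
  move=> /(chart_rcons uP FP quot c lq ry)/negP; apply; apply/eqP.
  by apply: y1; rewrite mem_rcons mem_head.
- exact: clsdD.
- by rewrite cE cat_rcons.
have -> : (T' `\` chart (rcons q c)) `\` chart q = T' `\` chart q.
  rewrite setDDl; congr (_ `\` _); apply/seteqP.
  split=> [z [/chart_belast|]//|z zq].
  by right.
(* The cell with pivot [c] supplies the top power of L, with exponent [size s2], in the geometric
   sum. *)
rewrite size_cat size_map size_rcons exprD -/Q -addrA; congr (_ + _).
by rewrite /= big_ord_recr /= -mulrDl -!mulrDr.
Qed.

Lemma k0_class_quotient : (0 < m)%N -> k0_class Z = \prod_(l < d) stage l.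
Proof.
move=> m0; rewrite -clsd_classT.
(* Without pivots the chart is all of [Z], so the remainder is empty. *)
rewrite (@clsd_class_cut_out m0 d [::] [::]) //.
  by rewrite (chart_nil P quot) setDv clsd_class0 add0r expr0 mul1r big_mkord.
exact: clsdT.
Qed.

End ClassOfQuotient.

(** * Products of geometric sums *)

Section GeometricProducts.
Variables (A : comPzRingType) (x u : A).
Hypothesis xu : (1 - x) * u = 1.

(** Multiplication by 1 - x telescopes the i-th factor to 1 - x^(a i + 1); the d factors 1 - x
    together form the denominator. *)
Lemma prod_geometric_qpochhammer a d :
  \prod_(i < d) (\sum_(j < a * i + 1) x ^+ j) =
  qpochhammer x (x ^+ a) d * uinv ((1 - x) ^+ d).
Proof.
have xd : (1 - x) ^+ d * uinv ((1 - x) ^+ d) = 1.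
  by apply: (@uinvP _ _ (u ^+ d)); rewrite -exprMn xu expr1n.
rewrite -[LHS]mulr1 -[X in _ * X = _]xd mulrA; congr (_ * _).
have -> : (1 - x) ^+ d = \prod_(i < d) (1 - x) by rewrite prodr_const card_ord.
rewrite /qpochhammer -big_split /=.
apply: eq_bigr => i _; rewrite -exprM -exprS mulrC -[1 - x]opprB mulNr.
by rewrite -subrX1 opprB addn1.
Qed.

Lemma prod_geometric_quotients a d :
  \prod_(i < d) (\sum_(j < a * i + 1) x ^+ j) =
  \prod_(i < d) ((x ^+ (a * i + 1) - 1) * uinv (x - 1)).
Proof.
have x1 : (x - 1) * uinv (x - 1) = 1.
  by apply: (@uinvP _ _ (- u)); rewrite mulrN -mulNr opprB.
by apply: eq_bigr => i _; rewrite subrX1 mulrAC x1 mul1r.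
Qed.

End GeometricProducts.

Local Open Scope complex_scope.

Theorem theorem7p1 (R : realType) (m : nat) (m_ge1 : (1 <= m)%N) (d : nat)
    (F : nat -> {vspace 'cV[R[i]]_d}) (flagF : complete_flag F)
    (Z : variety R[i]) (p : @stable_nilp R[i] m d F -> Z)
    (quotZ : geometric_quotient (@borel_orbit R[i] m d F) p) :
  let L : K0loc R[i] := lefschetz R[i] in
  motive Z = qpochhammer L (L ^+ (m - 1)) d * uinv ((1 - L) ^+ d) /\
  qpochhammer L (L ^+ (m - 1)) d * uinv ((1 - L) ^+ d) =
    \prod_(i < d) ((L ^+ ((m - 1) * i + 1) - 1) * uinv (L - 1)).
Proof.
(* The case i = 1 of the localization makes 1 - L invertible, as the geometric sums require. *)
move=> L; have := @one_sub_lefschetzX_uinv R[i] 1 isT; rewrite expr1 => L1.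
rewrite -(prod_geometric_qpochhammer L1).
split; last exact: prod_geometric_quotients L1 _ _.
have [P uP FP] := flag_basis flagF.
rewrite /motive (k0_class_quotient uP FP quotZ m_ge1) rmorph_prod.
apply: eq_bigr => i _; rewrite rmorph_sum.
by apply: eq_bigr => j _; rewrite rmorphXn.
Qed.
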